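(* Let $\mathcal C$ be a parsummable category. Then the $\Gamma$-parsummable category $\gamma(\mathcal C)$ is globally special.
   Context: Let $\omega=\{0,1,2,\dots\}$ and let $M$ be the monoid, under composition, of injective maps $\omega\to\omega$. For a set $X$, $EX$ denotes the category with object set $X$ and exactly one morphism between any two objects. Then $\mathcal M=EM$ is a strict monoidal category. An $\mathcal M$-category is a small category $\mathcal C$ with a strict (strictly associative and unital) action functor $\mathcal M\times\mathcal C\to\mathcal C$; morphisms are functors commuting strictly with the actions. For $u\in M$ write $u_*:\mathcal C\to\mathcal C$ for its action. An object $x$ is supported on $A\subseteq\omega$ if $u_*(x)=x$ for every $u\in M$ that is the identity on $A$; it is finitely supported if it is supported on some finite set; $\operatorname{supp}(x)$ is the intersection of all finite sets on which $x$ is supported (and $\omega$ if there is none). $\mathcal C$ is tame if all its objects are finitely supported. The box product $\mathcal C\boxtimes\mathcal D$ of $\mathcal M$-categories is the full subcategory of $\mathcal C\times\mathcal D$ (diagonal $\mathcal M$-action) on the pairs $(c,d)$ such that $c$ is supported on $A$ and $d$ on $B$ for some disjoint $A,B\subseteq\omega$; it is a symmetric monoidal product on tame $\mathcal M$-categories with unit the terminal category. A parsummable category is a commutative monoid for $\boxtimes$ in tame $\mathcal M$-categories: a tame $\mathcal M$-category $\mathcal C$ with an $\mathcal M$-equivariant functor $+:\mathcal C\boxtimes\mathcal C\to\mathcal C$ that is strictly associative, commutative and unital, with unit an object $0$ fixed by $\mathcal M$. Morphisms are $\mathcal M$-equivariant functors strictly preserving $0$ and $+$. $\Gamma$ is the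 category of the based sets $n_+=\{0,\dots,n\}$ (basepoint $0$) and based maps. A $\Gamma$-object in a category is a functor $X$ from $\Gamma$ with $X(0_+)$ terminal (extended to all finite based sets $S_+$ in the usual way). $\gamma(\mathcal C)$ is the $\Gamma$-object in parsummable categories with $\gamma(\mathcal C)(n_+)=\mathcal C^{\boxtimes n}$, the full subcategory of $\mathcal C^n$ on $n$-tuples of objects with pairwise disjoint supports; a based map $\lambda:m_+\to n_+$ acts on objects and morphisms by $(f_1,\dots,f_m)\mapsto(\sum_{\lambda(i)=j}f_i)_{1\le j\le n}$. It is considered as a $\Gamma$-$\mathcal M$-category ($\Gamma$-object in $\mathcal M$-categories) by forgetting structure. Fix for every countably infinite set $U$ a bijection $\kappa_U:\omega\to U$, with $\kappa_\omega=\mathrm{id}$. For an $\mathcal M$-category $\mathcal D$ put $\mathcal D[U]=\mathcal D$, and let an injection $j:U\to V$ induce $j_*:=(\kappa_V^{-1}j\kappa_U)_*:\mathcal D[U]\to\mathcal D[V]$. If a group $G$ acts on $U$, this makes $\mathcal D[U]$ a category with strict $G$-action; for a $\Gamma$-$\mathcal M$-category $Y$ the $\Gamma$-$G$-category $Y[U]$ (a $\Gamma$-object in small categories with $G$-action) is formed objectwise. For a finite group $G$, a universal $G$-set is a countable $G$-set in which every subgroup of $G$ occurs as stabilizer of infinitely many elements. For a finite set $S$ and $s\in S$ let $p_s:S_+\to1_+$ be the based map with $p_s^{-1}(1)=\{s\}$, and $P_S:Y(S_+)\to\operatorname{map}(S,Y(1_+))$ the functor with $s$-component $Y(p_s)$.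 A $\Gamma$-$G$-category $Y$ is special if for every subgroup $H\le G$ and every finite $H$-set $S$ the functor $(P_S)^H:Y(S_+)^H\to\operatorname{map}^H(S,Y(1_+))$ is a weak equivalence of categories (induces a weak equivalence on nerves); here $H$ acts diagonally on $Y(S_+)$ (through $Y$ and through $S$) and by conjugation on $\operatorname{map}(S,Y(1_+))$. A $\Gamma$-$\mathcal M$-category $Y$ is globally special if for every finite group $G$ and some (hence any) universal $G$-set $\mathcal U$ the $\Gamma$-$G$-category $Y[\mathcal U]$ is special. *)

(* Defs.v *)
From HB Require Import structures.
From mathcomp Require Import all_boot all_fingroup.
From mathcomp Require Import zify.
From mathcomp Require Import boolp classical_sets functions cardinality.
From Stdlib Require Import Relation_Operators.

Set Implicit Arguments.
Unset Strict Implicit.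
Unset Printing Implicit Defensive.

Local Open Scope classical_set_scope.
#[local] Obligation Tactic := idtac.

Lemma sig_eq (T : Type) (P : T -> Prop) (a b : {x | P x}) :
  proj1_sig a = proj1_sig b -> a = b.
Proof. by case: a b => [x hx] [y hy] /= e; apply: eq_exist. Qed.

(* A small category is given by a set of objects and one set of all morphisms,
   with source and target maps.  In this presentation strict identities between
   functors are plain equations between objects and between morphisms. *)
Record category := Category {
  ob : Type;
  mor : Type;
  cdom : mor -> ob;
  ccod : mor -> ob;
  idm : ob -> mor;
  ccomp : forall g f : mor, cdom g = ccod f -> mor;
  cdom_id : forall x, cdom (idm x) = x;
  ccod_id : forall x, ccod (idm x) = x;
  cdom_comp : forall g f h, cdom (@ccomp g f h) = cdom f;
  ccod_comp : forall g f h, ccod (@ccomp g f h) = ccod g;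
  ccomp1f : forall f h, @ccomp (idm (ccod f)) f h = f;
  ccompf1 : forall f h, @ccomp f (idm (cdom f)) h = f;
  ccompA : forall k g f hkg hgf hk hf,
    @ccomp k (@ccomp g f hgf) hk = @ccomp (@ccomp k g hkg) f hf
}.
Arguments ccomp {_} g f _.

Lemma ccomp_eq (C : category) (g f g' f' : mor C) h h' :
  g = g' -> f = f' -> ccomp g f h = ccomp g' f' h'.
Proof. by move=> e1 e2; subst; congr ccomp. Qed.

Lemma ccomp_idr (C : category) (f : mor C) x h : ccomp f (idm x) h = f.
Proof.
have e : x = cdom f by rewrite -(ccod_id x) h.
by move: h; rewrite e => h; apply: ccompf1.
Qed.

Lemma ccomp_idl (C : category) (f : mor C) x h : ccomp (idm x) f h = f.
Proof.
have e : x = ccod f by rewrite -h cdom_id.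
by move: h; rewrite e => h; apply: ccomp1f.
Qed.

Record functor (C D : category) := Functor {
  fob : ob C -> ob D;
  fmor : mor C -> mor D;
  fdom : forall f, cdom (fmor f) = fob (cdom f);
  fcod : forall f, ccod (fmor f) = fob (ccod f);
  fid : forall x, fmor (idm x) = idm (fob x);
  fcomp : forall g f h h', fmor (ccomp g f h) = ccomp (fmor g) (fmor f) h'
}.

Lemma functor_eq (C D : category) (F G : functor C D) :
  fob F = fob G -> fmor F = fmor G -> F = G.
Proof.
case: F G => [o m a b c d] [o' m' a' b' c' d'] /= e1 e2; subst.
by congr Functor; exact: Prop_irrelevance.
Qed.

Program Definition functor_comp (C D E : category) (G : functor D E)
    (F : functor C D) : functor C E :=
  @Functor C E (fun x => fob G (fob F x)) (fun f => fmor G (fmor F f)) _ _ _ _.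
Next Obligation. by move=> * /=; rewrite !fdom. Qed.
Next Obligation. by move=> * /=; rewrite !fcod. Qed.
Next Obligation. by move=> * /=; rewrite !fid. Qed.
Next Obligation.
move=> C D E G F g f h h'.
have e : cdom (fmor F g) = ccod (fmor F f) by rewrite fdom fcod h.
by rewrite (fcomp _ e) (fcomp _ h').
Qed.

(* [EX]: the morphism [(x, y)] is the unique one from [x] to [y]. *)
Program Definition indiscrete (X : Type) : category :=
  @Category X (X * X) fst snd (fun x => (x, x)) (fun g f _ => (f.1, g.2))
    _ _ _ _ _ _ _.
Next Obligation. by []. Qed.
Next Obligation. by []. Qed.
Next Obligation. by []. Qed.
Next Obligation. by []. Qed.
Next Obligation. by move=> X [x y]. Qed.
Next Obligation. by move=> X [x y]. Qed.
Next Obligation. by []. Qed.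

Program Definition prodcat (C D : category) : category :=
  @Category (ob C * ob D) (mor C * mor D)
    (fun f => (cdom f.1, cdom f.2)) (fun f => (ccod f.1, ccod f.2))
    (fun x => (idm x.1, idm x.2))
    (fun g f h => (ccomp g.1 f.1 (congr1 fst h), ccomp g.2 f.2 (congr1 snd h)))
    _ _ _ _ _ _ _.
Next Obligation. by move=> C D [x y] /=; rewrite !cdom_id. Qed.
Next Obligation. by move=> C D [x y] /=; rewrite !ccod_id. Qed.
Next Obligation. by move=> * /=; rewrite !cdom_comp. Qed.
Next Obligation. by move=> * /=; rewrite !ccod_comp. Qed.
Next Obligation. by move=> C D [f g] h /=; rewrite !ccomp1f. Qed.
Next Obligation. by move=> C D [f g] h /=; rewrite !ccompf1. Qed.
Next Obligation. by move=> *; congr pair; apply: ccompA. Qed.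

Program Definition powcat (I : Type) (C : category) : category :=
  @Category (I -> ob C) (I -> mor C)
    (fun f i => cdom (f i)) (fun f i => ccod (f i)) (fun x i => idm (x i))
    (fun g f h i => ccomp (g i) (f i) (congr1 (@^~ i) h))
    _ _ _ _ _ _ _.
Next Obligation. by move=> I C x; apply: funext => i; rewrite cdom_id. Qed.
Next Obligation. by move=> I C x; apply: funext => i; rewrite ccod_id. Qed.
Next Obligation. by move=> *; apply: funext => i /=; rewrite cdom_comp. Qed.
Next Obligation. by move=> *; apply: funext => i /=; rewrite ccod_comp. Qed.
Next Obligation. by move=> *; apply: funext => i /=; rewrite ccomp1f. Qed.
Next Obligation. by move=> *; apply: funext => i /=; rewrite ccompf1. Qed.
Next Obligation. by move=> *; apply: funext => i; apply: ccompA. Qed.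

Section Subcategory.
Variables (C : category) (P : ob C -> Prop) (Q : mor C -> Prop).
Hypothesis Qdom : forall f, Q f -> P (cdom f).
Hypothesis Qcod : forall f, Q f -> P (ccod f).
Hypothesis Qid : forall x, P x -> Q (idm x).
Hypothesis Qcomp : forall g f h, Q g -> Q f -> Q (ccomp g f h).

Program Definition subcategory : category :=
  @Category {x | P x} {f | Q f}
    (fun f => exist _ (cdom (proj1_sig f)) (Qdom (proj2_sig f)))
    (fun f => exist _ (ccod (proj1_sig f)) (Qcod (proj2_sig f)))
    (fun x => exist _ (idm (proj1_sig x)) (Qid (proj2_sig x)))
    (fun g f h => exist _
      (ccomp (proj1_sig g) (proj1_sig f) (congr1 (@proj1_sig _ _) h))
      (Qcomp _ (proj2_sig g) (proj2_sig f)))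
    _ _ _ _ _ _ _.
Next Obligation. by move=> [x hx]; apply: sig_eq; rewrite /= cdom_id. Qed.
Next Obligation. by move=> [x hx]; apply: sig_eq; rewrite /= ccod_id. Qed.
Next Obligation. by move=> *; apply: sig_eq; rewrite /= cdom_comp. Qed.
Next Obligation. by move=> *; apply: sig_eq; rewrite /= ccod_comp. Qed.
Next Obligation. by move=> *; apply: sig_eq; rewrite /= ccomp1f. Qed.
Next Obligation. by move=> *; apply: sig_eq; rewrite /= ccompf1. Qed.
Next Obligation. by move=> *; apply: sig_eq; apply: ccompA. Qed.

End Subcategory.

Program Definition fullsub (C : category) (P : ob C -> Prop) : category :=
  @subcategory C P (fun f => P (cdom f) /\ P (ccod f)) _ _ _ _.
Next Obligation. by move=> C P f []. Qed.
Next Obligation. by move=> C P f []. Qed.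
Next Obligation. by move=> C P x /=; rewrite cdom_id ccod_id. Qed.
Next Obligation. by move=> C P g f h [_ ?] [? _] /=; rewrite cdom_comp ccod_comp. Qed.

Program Definition fixcat (C : category) (I : Type) (J : I -> Prop)
    (a : I -> functor C C) : category :=
  @subcategory C (fun x => forall h, J h -> fob (a h) x = x)
    (fun f => forall h, J h -> fmor (a h) f = f) _ _ _ _.
Next Obligation. by move=> C I J a f Hf h hJ; rewrite -fdom Hf. Qed.
Next Obligation. by move=> C I J a f Hf h hJ; rewrite -fcod Hf. Qed.
Next Obligation. by move=> C I J a x Hx h hJ; rewrite fid Hx. Qed.
Next Obligation.
move=> C I J a g f e Hg Hf h hJ.
have e' : cdom (fmor (a h) g) = ccod (fmor (a h) f) by rewrite Hg ?Hf.
by rewrite (fcomp _ e'); apply: ccomp_eq; [exact: Hg|exact: Hf].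
Qed.

Program Definition fix_functor (C D : category) (I : Type) (J : I -> Prop)
    (a : I -> functor C C) (b : I -> functor D D) (F : functor C D)
    (Fob : forall h, J h -> forall x, fob F (fob (a h) x) = fob (b h) (fob F x))
    (Fmor : forall h, J h -> forall f, fmor F (fmor (a h) f) = fmor (b h) (fmor F f)) :
    functor (fixcat J a) (fixcat J b) :=
  @Functor (fixcat J a) (fixcat J b)
    (fun x => exist _ (fob F (proj1_sig x)) _)
    (fun f => exist _ (fmor F (proj1_sig f)) _) _ _ _ _.
Next Obligation.
by move=> C D I J a b F Fob Fmor [x hx] h hJ /=; rewrite -Fob // hx.
Qed.
Next Obligation.
by move=> C D I J a b F Fob Fmor [x hx] h hJ /=; rewrite -Fmor // hx.
Qed.
Next Obligation. by move=> *; apply: sig_eq; rewrite /= fdom. Qed.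
Next Obligation. by move=> *; apply: sig_eq; rewrite /= fcod. Qed.
Next Obligation. by move=> *; apply: sig_eq; rewrite /= fid. Qed.
Next Obligation. by move=> *; apply: sig_eq; apply: fcomp. Qed.

Definition is_terminal_category (C : category) :=
  exists (x : ob C), (forall y : ob C, y = x) /\ (forall f : mor C, f = idm x).

Record mono (m n : nat) := Mono {
  mono_fun :> 'I_m.+1 -> 'I_n.+1;
  monoP : forall i j : 'I_m.+1, i <= j -> mono_fun i <= mono_fun j
}.

Lemma mono_eq m n (f g : mono m n) : f =1 g -> f = g.
Proof.
case: f g => [f hf] [g hg] /= /funext e; subst.
by congr Mono; exact: Prop_irrelevance.
Qed.

Definition mono_id n : mono n n := @Mono n n id (fun _ _ h => h).
Definition mono_comp k m n (f : mono m n) (g : mono k m) : mono k n :=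
  @Mono k n (fun i => f (g i)) (fun i j h => monoP f (monoP g h)).

Record sset := SSet {
  simp : nat -> Type;
  sact : forall m n, mono m n -> simp n -> simp m;
  sact_id : forall n (x : simp n), sact (mono_id n) x = x;
  sact_comp : forall k m n (f : mono m n) (g : mono k m) (x : simp n),
    sact (mono_comp f g) x = sact g (sact f x)
}.

Record smap (X Y : sset) := SMap {
  sfun :> forall n, simp X n -> simp Y n;
  sfunP : forall m n (f : mono m n) (x : simp X n),
    sfun (sact f x) = sact f (sfun x)
}.

Program Definition smap_comp (X Y Z : sset) (g : smap Y Z) (f : smap X Y) :
    smap X Z := @SMap X Z (fun n x => g n (f n x)) _.
Next Obligation. by move=> * /=; rewrite !sfunP. Qed.

Program Definition sprod (X Y : sset) : sset :=
  @SSet (fun n => (simp X n * simp Y n)%type)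
    (fun m n f x => (sact f x.1, sact f x.2)) _ _.
Next Obligation. by move=> X Y n [x y] /=; rewrite !sact_id. Qed.
Next Obligation. by move=> X Y * /=; rewrite !sact_comp. Qed.

Program Definition simplex (n : nat) : sset :=
  @SSet (fun k => mono k n) (fun m k f x => mono_comp x f) _ _.
Next Obligation. by move=> *; apply: mono_eq. Qed.
Next Obligation. by move=> *; apply: mono_eq. Qed.

(* The simplices of the horn opposite to the vertex [i]: they miss a vertex
   other than [i]. *)
Program Definition horn (n : nat) (i : 'I_n.+1) : sset :=
  @SSet (fun k => {x : mono k n | exists j, j <> i /\ forall l, x l <> j})
    (fun m k f x => exist _ (mono_comp (proj1_sig x) f) _) _ _.
Next Obligation.
by move=> n i m k f [x [j [ji jx]]]; exists j; split=> // l /=; apply: jx.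
Qed.
Next Obligation. by move=> *; apply: sig_eq; apply: mono_eq. Qed.
Next Obligation. by move=> *; apply: sig_eq; apply: mono_eq. Qed.

Definition is_kan (Z : sset) :=
  forall (n : nat) (i : 'I_n.+1), 0 < n ->
  forall h : smap (horn i) Z, exists e : smap (simplex n) Z,
  forall k (x : simp (horn i) k), h k x = e k (proj1_sig x).

Definition mono_const k n (i : 'I_n.+1) : mono k n :=
  @Mono k n (fun _ => i) (fun _ _ _ => leqnn i).

Definition elementary_homotopy (X Z : sset) (f g : smap X Z) :=
  exists h : smap (sprod X (simplex 1)) Z,
    (forall k (x : simp X k), h k (x, mono_const k ord0) = f k x) /\
    (forall k (x : simp X k), h k (x, mono_const k ord_max) = g k x).

Definition homotopic (X Z : sset) : smap X Z -> smap X Z -> Prop :=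
  clos_refl_sym_trans (smap X Z) (@elementary_homotopy X Z).

(* Weak homotopy equivalences of simplicial sets, without geometric
   realization: for every Kan complex [Z], restriction along [w] is a bijection
   [pi_0 Fun(Y, Z) -> pi_0 Fun(X, Z)] (Kerodon, Definition 3.1.6.12). *)
Definition is_weak_equivalence (X Y : sset) (w : smap X Y) :=
  forall Z : sset, is_kan Z ->
    (forall f : smap X Z, exists g : smap Y Z, homotopic (smap_comp g w) f) /\
    (forall g g' : smap Y Z,
       homotopic (smap_comp g w) (smap_comp g' w) -> homotopic g g').

Program Definition ordcat (n : nat) : category :=
  @Category 'I_n.+1 {p : 'I_n.+1 * 'I_n.+1 | p.1 <= p.2}
    (fun f => (proj1_sig f).1) (fun f => (proj1_sig f).2)
    (fun i => exist _ (i, i) (leqnn i))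
    (fun g f h => exist _ ((proj1_sig f).1, (proj1_sig g).2) _)
    _ _ _ _ _ _ _.
Next Obligation.
by move=> n [[a b] /= ab] [[c d] /= cd] /= e; subst; apply: leq_trans ab.
Qed.
Next Obligation. by []. Qed.
Next Obligation. by []. Qed.
Next Obligation. by []. Qed.
Next Obligation. by []. Qed.
Next Obligation. by move=> n [[a b] ab] h; apply: sig_eq. Qed.
Next Obligation. by move=> n [[a b] ab] h; apply: sig_eq. Qed.
Next Obligation. by move=> *; apply: sig_eq. Qed.

Program Definition ordcat_map m n (f : mono m n) : functor (ordcat m) (ordcat n) :=
  @Functor (ordcat m) (ordcat n) f
    (fun p => exist _ (f (proj1_sig p).1, f (proj1_sig p).2) (monoP f (proj2_sig p)))
    _ _ _ _.
Next Obligation. by []. Qed.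
Next Obligation. by []. Qed.
Next Obligation. by move=> *; apply: sig_eq. Qed.
Next Obligation. by move=> *; apply: sig_eq. Qed.

Program Definition nerve (C : category) : sset :=
  @SSet (fun n => functor (ordcat n) C)
    (fun m n f x => functor_comp x (ordcat_map f)) _ _.
Next Obligation.
move=> C n x; apply: functor_eq; apply: funext => // -[[a b] ab] /=.
by congr fmor; apply: sig_eq.
Qed.
Next Obligation. by move=> *; apply: functor_eq; apply: funext. Qed.

Program Definition nerve_map (C D : category) (F : functor C D) :
    smap (nerve C) (nerve D) :=
  @SMap (nerve C) (nerve D) (fun n x => functor_comp F x) _.
Next Obligation. by move=> *; apply: functor_eq; apply: funext. Qed.

Definition is_weak_equivalence_cat (C D : category) (F : functor C D) :=
  is_weak_equivalence (nerve_map F).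

Record inj := Inj { inj_fun :> nat -> nat; injP : injective inj_fun }.

Lemma inj_eq_ext (u v : inj) : u =1 v -> u = v.
Proof.
case: u v => [f hf] [g hg] /= /funext e; subst.
by congr Inj; exact: Prop_irrelevance.
Qed.

Definition inj_one : inj := @Inj id (fun _ _ => id).
Definition inj_mul (u v : inj) : inj :=
  @Inj (fun n => u (v n)) (fun _ _ h => injP (injP h)).

Definition EM : category := indiscrete inj.

Record Mcat := MCat {
  mcat :> category;
  mact : functor (prodcat EM mcat) mcat;
  mact1_ob : forall x, fob mact (inj_one, x) = x;
  mact1_mor : forall f, fmor mact ((inj_one, inj_one), f) = f;
  mactM_ob : forall u v x,
    fob mact (inj_mul u v, x) = fob mact (u, fob mact (v, x));
  mactM_mor : forall u u' v v' f,
    fmor mact ((inj_mul u v, inj_mul u' v'), f)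
    = fmor mact ((u, u'), fmor mact ((v, v'), f))
}.

(* [aob u x] is [u_* x]; for [f : x -> y], [amor u v f] is the morphism
   [u_* x -> v_* y] which the action assigns to [f] and [(u, v) : u -> v]. *)
Definition aob (C : Mcat) (u : inj) (x : ob C) : ob C := fob (mact C) (u, x).
Definition amor (C : Mcat) (u v : inj) (f : mor C) : mor C :=
  fmor (mact C) ((u, v), f).

Lemma aob1 (C : Mcat) (x : ob C) : aob inj_one x = x.
Proof. exact: mact1_ob. Qed.
Lemma aobM (C : Mcat) u v (x : ob C) : aob (inj_mul u v) x = aob u (aob v x).
Proof. exact: mactM_ob. Qed.
Lemma amor1 (C : Mcat) (f : mor C) : amor inj_one inj_one f = f.
Proof. exact: mact1_mor. Qed.
Lemma amorM (C : Mcat) u u' v v' (f : mor C) :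
  amor (inj_mul u v) (inj_mul u' v') f = amor u u' (amor v v' f).
Proof. exact: mactM_mor. Qed.
Lemma cdom_amor (C : Mcat) u v (f : mor C) : cdom (amor u v f) = aob u (cdom f).
Proof. exact: fdom. Qed.
Lemma ccod_amor (C : Mcat) u v (f : mor C) : ccod (amor u v f) = aob v (ccod f).
Proof. exact: fcod. Qed.
Lemma amor_id (C : Mcat) u (x : ob C) : amor u u (idm x) = idm (aob u x).
Proof. exact: (fid (mact C) (u, x)). Qed.
Lemma amor_comp (C : Mcat) u v w (g f : mor C) h h' :
  amor u w (ccomp g f h) = ccomp (amor v w g) (amor u v f) h'.
Proof.
pose G : mor (prodcat EM C) := ((v, w), g).
pose F : mor (prodcat EM C) := ((u, v), f).
have e : cdom G = ccod F by congr pair.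
rewrite -(@fcomp _ _ (mact C) G F e); congr (fmor (mact C)).
by congr pair; apply: ccomp_eq.
Qed.

Program Definition astar (C : Mcat) (u : inj) : functor C C :=
  @Functor C C (@aob C u) (@amor C u u) _ _ _ _.
Next Obligation. by move=> * /=; rewrite cdom_amor. Qed.
Next Obligation. by move=> * /=; rewrite ccod_amor. Qed.
Next Obligation. by move=> * /=; rewrite amor_id. Qed.
Next Obligation. by move=> *; apply: amor_comp. Qed.

Record Mfunctor (C D : Mcat) := MFunctor {
  mfun :> functor C D;
  mfun_ob : forall u x, fob mfun (aob u x) = aob u (fob mfun x);
  mfun_mor : forall u v f, fmor mfun (amor u v f) = amor u v (fmor mfun f)
}.

Definition supported (C : Mcat) (x : ob C) (A : set nat) :=
  forall u : inj, (forall n, A n -> u n = n) -> aob u x = x.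

Definition finitely_supported (C : Mcat) (x : ob C) :=
  exists A : set nat, finite_set A /\ supported x A.

Definition supp (C : Mcat) (x : ob C) : set nat :=
  \bigcap_(A in [set A : set nat | finite_set A /\ supported x A]) A.

Definition tame (C : Mcat) := forall x : ob C, finitely_supported x.

Lemma supportedS (C : Mcat) (x : ob C) (A B : set nat) :
  A `<=` B -> supported x A -> supported x B.
Proof. by move=> AB h u hu; apply: h => n /AB; apply: hu. Qed.

Definition swapn (a b n : nat) : nat :=
  if n == a then b else if n == b then a else n.

Lemma swapnK a b : involutive (swapn a b).
Proof.
move=> n; rewrite /swapn.
case: (eqVneq n a) => [->|na]; first by rewrite eqxx; case: eqVneq.
case: (eqVneq n b) => [->|nb]; first by rewrite eqxx.
by rewrite (negbTE na) (negbTE nb).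
Qed.

Lemma inj_extend_perm (u : inj) (s : seq nat) :
  exists w w' : inj, [/\ cancel w w', cancel w' w & forall n, n \in s -> w n = u n].
Proof.
elim: s => [|a s [w [w' [wK w'K ws]]]]; first by exists inj_one, inj_one.
have [ins|nins] := boolP (a \in s).
  exists w, w'; split=> // n; rewrite inE => /orP[/eqP->|]; exact: ws.
pose t := @Inj (swapn (w a) (u a)) (inv_inj (@swapnK _ _)).
exists (inj_mul t w), (inj_mul w' t); split.
- by move=> n; rewrite /= swapnK wK.
- by move=> n; rewrite /= w'K swapnK.
move=> n; rewrite inE => /orP[/eqP->|ns] /=; first by rewrite /swapn eqxx.
have na : n != a by apply: contraNneq nins => <-.
rewrite /swapn ws // -(ws n ns) (inj_eq (@injP w)) (negbTE na) ws //.
by rewrite (inj_eq (@injP u)) (negbTE na).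
Qed.

Lemma supported_eq (C : Mcat) (x : ob C) (A : set nat) (u v : inj) :
  finite_set A -> supported x A -> (forall n, A n -> u n = v n) ->
  aob u x = aob v x.
Proof.
move=> /finite_seqP[s As] sA uv.
have [w [w' [wK w'K ws]]] := inj_extend_perm u s.
have key (t : inj) : (forall n, A n -> w n = t n) -> aob t x = aob w x.
  move=> wt; have -> : t = inj_mul w (inj_mul w' t).
    by apply: inj_eq_ext => n /=; rewrite w'K.
  by rewrite aobM; congr aob; apply: sA => n An /=; rewrite -wt // wK.
have uw n : A n -> w n = u n by rewrite As /= => /ws.
by rewrite (key u uw) (key v) // => n An; rewrite -uv // uw.
Qed.

Lemma supported_aob (C : Mcat) (x : ob C) (A : set nat) (u : inj) :
  finite_set A -> supported x A -> supported (aob u x) (u @` A).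
Proof.
move=> fA sA v hv; rewrite -aobM; apply: (supported_eq fA sA) => n An /=.
by apply: hv; exists n.
Qed.

Lemma finite_set_bounded (A : set nat) :
  finite_set A -> exists N, forall n, A n -> n < N.
Proof.
move=> /finite_seqP[s ->]; exists (\max_(i <- s) i).+1 => n /= ns.
by rewrite ltnS; apply: leq_bigmax_seq.
Qed.

Lemma supportedI (C : Mcat) (x : ob C) (A B : set nat) :
  finite_set A -> finite_set B -> supported x A -> supported x B ->
  supported x (A `&` B).
Proof.
move=> fA fB sA sB u hu.
have fAB : finite_set (A `|` B) by rewrite finite_setU.
have [N hN] := finite_set_bounded fAB.
have [K hK] : exists K, forall n, A n \/ B n -> u n < K /\ n < K.
  have [K hK] := finite_set_bounded (finite_image u fAB).
  exists (maxn K N) => n ABn; rewrite !leq_max.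
  by rewrite (hN n) // (hK (u n)) ?orbT //; exists n.
(* [s] fixes [A] and moves [B \ A] beyond [K] *)
have [s [sA_ sB_]] : exists s : inj, (forall n, A n -> s n = n) /\
    (forall n, ~ A n -> s n = K + n).
  have inj_s : injective (fun n => if `[< A n >] then n else K + n).
    move=> m n; case: asboolP => Am; case: asboolP => An //.
    - by move=> e; have [_] := hK _ (or_introl Am); rewrite e ltnNge leq_addr.
    - by move=> e; have [_] := hK _ (or_introl An); rewrite -e ltnNge leq_addr.
    - exact: addnI.
  by exists (Inj inj_s); split=> n An /=; case: asboolP.
have sx : aob s x = x by apply: sA.
have ssB : supported x (s @` B) by rewrite -sx; apply: supported_aob.
(* [v] agrees with [u] on [A] and is the identity on [s @` B] *)
have [v [vA vB]] : exists v : inj, (forall n, A n -> v n = u n) /\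
    (forall n, (s @` B) n -> v n = n).
  have inj_v : injective (fun n => if `[< A n >] then u n else
      if n < K then K + K + n else if n < K + K then n else n + K).
    move=> m n; case: asboolP => Am; case: asboolP => An.
    - exact: injP.
    - have [] := hK _ (or_introl Am).
      by case: (ltnP n K) => ?; [|case: (ltnP n (K + K)) => ?]; lia.
    - have [] := hK _ (or_introl An).
      by case: (ltnP m K) => ?; [|case: (ltnP m (K + K)) => ?]; lia.
    - by case: (ltnP n K) => ?; [|case: (ltnP n (K + K)) => ?];
        (case: (ltnP m K) => ?; [|case: (ltnP m (K + K)) => ?]); lia.
  exists (Inj inj_v); split=> [n An|_ [b Bb <-]] /=; first by case: asboolP.
  case: (asboolP (A b)) => Ab.
    by rewrite (sA_ _ Ab); case: asboolP => // _; apply: hu.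
  have [_ bK] := hK _ (or_intror Bb); rewrite (sB_ _ Ab).
  case: asboolP => [/(or_introl (B := B (K + b)))/hK[_]|_]; first by lia.
  by rewrite ltnNge leq_addr /= ltn_add2l bK.
rewrite (supported_eq fA sA (v := v)); last by move=> n /vA.
exact: ssB.
Qed.

Lemma supp_min (C : Mcat) (x : ob C) : finitely_supported x ->
  finite_set (supp x) /\ supported x (supp x).
Proof.
move=> [A [fA sA]].
have [A0 [fA0 sA0 A0min]] : exists A0 : set nat, [/\ finite_set A0, supported x A0 &
    forall B, finite_set B -> supported x B -> A0 `<=` B].
  move: fA sA => /finite_seqP[s ->]; have [n] := ubnP (size s).
  elim: n s {A} => // n IH s; rewrite ltnS => sn ss.
  have [h|/existsNP[B /not_implyP[fB /not_implyP[sB /existsNP[a /not_implyP[ain aB]]]]]]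
    := pselect (forall B, finite_set B -> supported x B -> [set` s] `<=` B).
    by exists [set` s]; split.
  apply: (IH [seq b <- s | `[< B b >]]).
    apply: leq_trans sn; rewrite size_filter -(count_predC (fun b => `[< B b >])).
    rewrite -[X in X < _]addn0 ltn_add2l -has_count; apply/hasP; exists a => //=.
    exact/asboolPn.
  apply: supportedS (supportedI (finite_seq s) fB ss sB) => b /= [bs Bb].
  by rewrite mem_filter bs andbT; apply/asboolP.
have -> : supp x = A0; last by split.
by apply/seteqP; split => [n h|n An B [fB sB]]; [apply: h|apply: A0min].
Qed.

Lemma supp_sub (C : Mcat) (x : ob C) (A : set nat) :
  finite_set A -> supported x A -> supp x `<=` A.
Proof. by move=> fA sA n; apply. Qed.

Program Definition prodM (C D : Mcat) : Mcat :=
  @MCat (prodcat C D)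
    (@Functor (prodcat EM (prodcat C D)) (prodcat C D)
      (fun p => (aob p.1 p.2.1, aob p.1 p.2.2))
      (fun f => (amor f.1.1 f.1.2 f.2.1, amor f.1.1 f.1.2 f.2.2)) _ _ _ _)
    _ _ _ _.
Next Obligation. by move=> C D [[u v] [f g]] /=; rewrite !cdom_amor. Qed.
Next Obligation. by move=> C D [[u v] [f g]] /=; rewrite !ccod_amor. Qed.
Next Obligation. by move=> C D [u [x y]] /=; rewrite !amor_id. Qed.
Next Obligation.
move=> C D [[v w] [g g']] [[u v'] [f f']] h h' /=.
by case: (h) => /= e _ _; subst; congr pair; apply: amor_comp.
Qed.
Next Obligation. by move=> C D [x y] /=; rewrite !aob1. Qed.
Next Obligation. by move=> C D [x y] /=; rewrite !amor1. Qed.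
Next Obligation. by move=> C D u v [x y] /=; rewrite !aobM. Qed.
Next Obligation. by move=> C D u u' v v' [x y] /=; rewrite !amorM. Qed.

Program Definition powM (I : Type) (C : Mcat) : Mcat :=
  @MCat (powcat I C)
    (@Functor (prodcat EM (powcat I C)) (powcat I C)
      (fun p i => aob p.1 (p.2 i)) (fun f i => amor f.1.1 f.1.2 (f.2 i)) _ _ _ _)
    _ _ _ _.
Next Obligation. by move=> I C [[u v] f]; apply: funext => i /=; rewrite cdom_amor. Qed.
Next Obligation. by move=> I C [[u v] f]; apply: funext => i /=; rewrite ccod_amor. Qed.
Next Obligation. by move=> I C [u x]; apply: funext => i /=; rewrite amor_id. Qed.
Next Obligation.
move=> I C [[v w] g] [[u v'] f] h h' /=.
by case: (h) => /= e _; subst; apply: funext => i; apply: amor_comp.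
Qed.
Next Obligation. by move=> I C x; apply: funext => i /=; rewrite aob1. Qed.
Next Obligation. by move=> I C x; apply: funext => i /=; rewrite amor1. Qed.
Next Obligation. by move=> I C u v x; apply: funext => i /=; rewrite aobM. Qed.
Next Obligation. by move=> I C u u' v v' x; apply: funext => i /=; rewrite amorM. Qed.

Program Definition fullsubM (C : Mcat) (P : ob C -> Prop)
    (Pact : forall u x, P x -> P (aob u x)) : Mcat :=
  @MCat (fullsub P)
    (@Functor (prodcat EM (fullsub P)) (fullsub P)
      (fun p => exist _ (aob p.1 (proj1_sig p.2)) (Pact _ _ (proj2_sig p.2)))
      (fun f => exist _ (amor f.1.1 f.1.2 (proj1_sig f.2)) _) _ _ _ _)
    _ _ _ _.
Next Obligation.
by move=> C P Pact [[u v] [f [h1 h2]]] /=; rewrite cdom_amor ccod_amor; split; apply: Pact.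
Qed.
Next Obligation. by move=> *; apply: sig_eq; rewrite /= cdom_amor. Qed.
Next Obligation. by move=> *; apply: sig_eq; rewrite /= ccod_amor. Qed.
Next Obligation. by move=> *; apply: sig_eq; rewrite /= amor_id. Qed.
Next Obligation.
move=> C P Pact [[v w] g] [[u v'] f] h h'; apply: sig_eq => /=.
by case: (h) => /= e _; subst; apply: amor_comp.
Qed.
Next Obligation. by move=> *; apply: sig_eq; rewrite /= aob1. Qed.
Next Obligation. by move=> *; apply: sig_eq; rewrite /= amor1. Qed.
Next Obligation. by move=> *; apply: sig_eq; rewrite /= aobM. Qed.
Next Obligation. by move=> *; apply: sig_eq; rewrite /= amorM. Qed.

(* The sets have to be finite: an injection which is the identity away from one
   point is the identity, so that every object is supported on the complement
   of every point.  On tame M-categories the condition means that the supports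
   are disjoint, see [disjointly_supportedP]. *)
Definition disjointly_supported (C D : Mcat) (x : ob C) (y : ob D) :=
  exists A B : set nat, [/\ finite_set A, finite_set B, A `&` B = set0,
    supported x A & supported y B].

Lemma disjointly_supportedP (C D : Mcat) (x : ob C) (y : ob D) :
  finitely_supported x -> finitely_supported y ->
  disjointly_supported x y <-> supp x `&` supp y = set0.
Proof.
move=> /supp_min[fx sx] /supp_min[fy sy]; split; last first.
  by move=> h; exists (supp x), (supp y); split.
move=> [A [B [fA fB AB sA sB]]]; rewrite -subset0 -AB => n [nx ny].
by split; [exact: supp_sub nx|exact: supp_sub ny].
Qed.

Lemma image_disj (u : inj) (A B : set nat) :
  A `&` B = set0 -> (u @` A) `&` (u @` B) = set0.
Proof.
move=> AB; rewrite -subset0 => _ [[n An <-] [m Bm /injP mn]].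
by suff : set0 n by []; rewrite -AB; split=> //; rewrite -mn.
Qed.

Lemma disjointly_supported_act (C D : Mcat) (u : inj) (x : ob C) (y : ob D) :
  disjointly_supported x y -> disjointly_supported (aob u x) (aob u y).
Proof.
move=> [A [B [fA fB AB sA sB]]]; exists (u @` A), (u @` B).
split; [exact: finite_image|exact: finite_image|exact: image_disj| |];
  exact: supported_aob.
Qed.

Program Definition box (C D : Mcat) : Mcat :=
  @fullsubM (prodM C D) (fun p => disjointly_supported p.1 p.2) _.
Next Obligation. by move=> C D u [x y] /=; apply: disjointly_supported_act. Qed.

Definition box_ob (C D : Mcat) (x : ob C) (y : ob D)
    (h : disjointly_supported x y) : ob (box C D) := exist _ (x, y) h.

Definition box_mor (C D : Mcat) (f : mor C) (g : mor D)
    (h : disjointly_supported (cdom f) (cdom g))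
    (h' : disjointly_supported (ccod f) (ccod g)) : mor (box C D) :=
  exist _ (f, g) (conj h h').

(* In the associativity axioms the hypotheses [h1] to [h4] on sums follow from
   pairwise disjointness of the summands. *)
Record parsummable := Parsummable {
  pcat :> Mcat;
  ptame : tame pcat;
  padd : Mfunctor (box pcat pcat) pcat;
  pzero : ob pcat;
  pzero_fixed : forall u, aob u pzero = pzero;
  paddx0_ob : forall x (h : disjointly_supported x pzero),
    fob padd (box_ob h) = x;
  paddx0_mor : forall f h h',
    fmor padd (@box_mor _ _ f (idm pzero) h h') = f;
  paddC_ob : forall x y (h : disjointly_supported x y) (h' : disjointly_supported y x),
    fob padd (box_ob h) = fob padd (box_ob h');
  paddC_mor : forall f g hd hc hd' hc',
    fmor padd (@box_mor _ _ f g hd hc) = fmor padd (@box_mor _ _ g f hd' hc');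
  paddA_ob : forall x y z (hxy : disjointly_supported x y)
      (hyz : disjointly_supported y z) (hxz : disjointly_supported x z) h1 h2,
    fob padd (@box_ob _ _ (fob padd (box_ob hxy)) z h1)
    = fob padd (@box_ob _ _ x (fob padd (box_ob hyz)) h2);
  paddA_mor : forall (f g k : mor pcat)
      (hfg : disjointly_supported (cdom f) (cdom g))
      (hfg' : disjointly_supported (ccod f) (ccod g))
      (hgk : disjointly_supported (cdom g) (cdom k))
      (hgk' : disjointly_supported (ccod g) (ccod k))
      (hfk : disjointly_supported (cdom f) (cdom k))
      (hfk' : disjointly_supported (ccod f) (ccod k)) h1 h2 h3 h4,
    fmor padd (@box_mor _ _ (fmor padd (box_mor hfg hfg')) k h1 h2)
    = fmor padd (@box_mor _ _ f (fmor padd (box_mor hgk hgk')) h3 h4)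
}.

(* The sum, extended by the value [pzero] to pairs which are not disjointly
   supported, and likewise for morphisms. *)
Definition tadd_ob (C : parsummable) (x y : ob C) : ob C :=
  match pselect (disjointly_supported x y) with
  | left h => fob (padd C) (box_ob h)
  | right _ => pzero C
  end.

Definition tadd_mor (C : parsummable) (f g : mor C) : mor C :=
  match pselect (disjointly_supported (cdom f) (cdom g)),
        pselect (disjointly_supported (ccod f) (ccod g)) with
  | left h, left h' => fmor (padd C) (box_mor h h')
  | _, _ => idm (pzero C)
  end.

(* Finite sums in a commutative monoid whose addition is only well behaved for
   elements with disjoint bounds: [pcm_bound x A] says that [A] is a bound for
   [x]. *)
Record pcm (K X : Type) := Pcm {
  pcm_bound : X -> set K -> Prop;
  pcm_add : X -> X -> X;
  pcm_zero : X;
  pcm_bound0 : pcm_bound pcm_zero set0;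
  pcm_boundD : forall x y A B, pcm_bound x A -> pcm_bound y B ->
    A `&` B = set0 -> pcm_bound (pcm_add x y) (A `|` B);
  pcm_addx0 : forall x A, pcm_bound x A -> pcm_add x pcm_zero = x;
  pcm_addC : forall x y A B, pcm_bound x A -> pcm_bound y B ->
    A `&` B = set0 -> pcm_add x y = pcm_add y x;
  pcm_addA : forall x y z A B D,
    pcm_bound x A -> pcm_bound y B -> pcm_bound z D ->
    A `&` B = set0 -> A `&` D = set0 -> B `&` D = set0 ->
    pcm_add x (pcm_add y z) = pcm_add (pcm_add x y) z
}.

Section Tracked.
Variables (K X : Type) (M : pcm K X).

Definition tracked := option {p : X * set K | pcm_bound M p.1 p.2}.

Definition tr (x : X) (A : set K) (h : pcm_bound M x A) : tracked :=
  Some (exist _ (x, A) h).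

Definition tr_add (a b : tracked) : tracked :=
  match a, b with
  | Some a, Some b =>
    match pselect ((proj1_sig a).2 `&` (proj1_sig b).2 = set0) with
    | left h => tr (pcm_boundD (proj2_sig a) (proj2_sig b) h)
    | right _ => None
    end
  | _, _ => None
  end.

Definition tr_zero : tracked := tr (pcm_bound0 M).

Lemma tr_eq x A h y B h' : x = y -> A = B -> @tr x A h = @tr y B h'.
Proof. by move=> e1 e2; subst; congr Some; apply: sig_eq. Qed.

Lemma trP (a : tracked) : a = None \/ exists x A h, a = @tr x A h.
Proof. by case: a => [[[x A] h]|]; [right; exists x, A, h|left]. Qed.

Lemma trD x A hx y B hy (h : A `&` B = set0) :
  tr_add (@tr x A hx) (@tr y B hy) = tr (pcm_boundD hx hy h).
Proof. by rewrite /tr_add /=; case: pselect => // h'; apply: tr_eq. Qed.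

Lemma trDN x A hx y B hy : A `&` B <> set0 ->
  tr_add (@tr x A hx) (@tr y B hy) = None.
Proof. by rewrite /tr_add /=; case: pselect. Qed.

Lemma tr_addNr a : tr_add a None = None. Proof. by case: a. Qed.

Lemma tr_addC : commutative tr_add.
Proof.
move=> a b; have [->|[x [A [hx ->]]]] := trP a; first by rewrite tr_addNr.
have [->|[y [B [hy ->]]]] := trP b; first by rewrite tr_addNr.
have [h|h] := pselect (A `&` B = set0).
  have h' : B `&` A = set0 by rewrite setIC.
  rewrite (trD hx hy h) (trD hy hx h'); apply: tr_eq; last by rewrite setUC.
  exact: pcm_addC hx hy h.
by rewrite (trDN hx hy h) (trDN hy hx) // setIC.
Qed.

Lemma tr_addA : associative tr_add.
Proof.
move=> a b d; have [->|[x [A [hx ->]]]] := trP a; first by [].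
have [->|[y [B [hy ->]]]] := trP b; first by [].
have [->|[z [D [hz ->]]]] := trP d; first by rewrite !tr_addNr.
have [hBD|hBD] := pselect (B `&` D = set0); last first.
  rewrite (trDN hy hz hBD) tr_addNr.
  have [hAB|hAB] := pselect (A `&` B = set0); last by rewrite (trDN hx hy hAB).
  rewrite (trD hx hy hAB) trDN // => h; apply: hBD; rewrite -subset0 -h.
  by apply: setSI; apply: subsetUr.
have [hAB|hAB] := pselect (A `&` B = set0); last first.
  rewrite (trDN hx hy hAB) (trD hy hz hBD) trDN // => h; apply: hAB.
  by rewrite -subset0 -h; apply: setIS; apply: subsetUl.
rewrite (trD hx hy hAB) (trD hy hz hBD).
have [hAD|hAD] := pselect (A `&` D = set0); last first.
  rewrite !trDN // => h; apply: hAD; rewrite -subset0 -h.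
    by apply: setSI; apply: subsetUl.
  by apply: setIS; apply: subsetUr.
rewrite !trD ?setIUr ?setIUl ?hAB ?hAD ?hBD ?setU0 // => h1 h2.
by apply: tr_eq; [exact: pcm_addA hx hy hz _ _ _|rewrite setUA].
Qed.

Lemma tr_add0 : left_id tr_zero tr_add.
Proof.
move=> a; have [->|[x [A [hx ->]]]] := trP a; first by [].
rewrite tr_addC trD ?setI0 // => h.
by apply: tr_eq; [exact: pcm_addx0 hx|rewrite setU0].
Qed.

HB.instance Definition _ :=
  Monoid.isComLaw.Build tracked tr_zero tr_add tr_addA tr_addC tr_add0.

Variables (I : finType) (x : I -> X) (A : I -> set K).
Hypothesis xA : forall i, pcm_bound M (x i) (A i).
Hypothesis Adisj : forall i j, i != j -> A i `&` A j = set0.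

Notation sum r P := (\big[pcm_add M/pcm_zero M]_(i <- r | P i) x i).

Lemma disj_notin (P : pred I) i r : i \notin r ->
  A i `&` \big[setU/set0]_(j <- r | P j) A j = set0.
Proof.
elim: r => [|j r IH]; first by rewrite big_nil setI0.
rewrite inE negb_or big_cons => /andP[ij /IH h]; case: ifP => // _.
by rewrite setIUr Adisj // h setU0.
Qed.

Lemma sum_boundP (P : pred I) r : uniq r ->
  exists h : pcm_bound M (sum r P) (\big[setU/set0]_(i <- r | P i) A i),
  \big[tr_add/tr_zero]_(i <- r | P i) tr (xA i) = tr h.
Proof.
elim: r => [|i r IH] /=.
  by rewrite !big_nil => _; exists (pcm_bound0 M).
move=> /andP[ir /IH[h e]]; rewrite !big_cons; case: (P i); last by exists h.
rewrite e; have d := disj_notin P ir.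
by exists (pcm_boundD (xA i) h d); rewrite -trD.
Qed.

Lemma sum_bound (P : pred I) :
  pcm_bound M (\big[pcm_add M/pcm_zero M]_(i | P i) x i)
    (\big[setU/set0]_(i | P i) A i).
Proof. by have [] := sum_boundP P (index_enum_uniq I). Qed.

Lemma tr_sum (P : pred I) :
  \big[tr_add/tr_zero]_(i | P i) tr (xA i) = tr (sum_bound P).
Proof. by have [h ->] := sum_boundP P (index_enum_uniq I); apply: tr_eq. Qed.

Lemma sum_pred1 j : \big[pcm_add M/pcm_zero M]_(i | i == j) x i = x j.
Proof.
have := tr_sum (fun i => i == j); rewrite (big_pred1 j) //.
by rewrite /tr => -[].
Qed.

Lemma bigUP (P : pred I) k : (\big[setU/set0]_(i | P i) A i) k ->
  exists2 i, P i & A i k.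
Proof.
elim/big_ind: _ => // [B D hB hD [/hB|/hD] //|i Pi Aik]; by exists i.
Qed.

Lemma bigU_disj (P Q : pred I) : (forall i, P i -> ~~ Q i) ->
  (\big[setU/set0]_(i | P i) A i) `&` (\big[setU/set0]_(i | Q i) A i) = set0.
Proof.
move=> PQ; rewrite -subset0 => k [/bigUP[i Pi Aik] /bigUP[j Qj Ajk]].
have ij : i != j by apply: contraTneq Qj => <-; apply: PQ.
by rewrite -(Adisj ij); split.
Qed.

End Tracked.

Lemma sum_sum (K X : Type) (M : pcm K X) (I J : finType) (x : I -> X)
    (A : I -> set K) (xA : forall i, pcm_bound M (x i) (A i))
    (Adisj : forall i j, i != j -> A i `&` A j = set0)
    (R : I -> pred J) (Q : pred J) (P : pred I) :
  (forall i j j', R i j -> R i j' -> j = j') ->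
  (forall i, P i <-> exists2 j, Q j & R i j) ->
  \big[pcm_add M/pcm_zero M]_(j | Q j)
     \big[pcm_add M/pcm_zero M]_(i | R i j) x i
  = \big[pcm_add M/pcm_zero M]_(i | P i) x i.
Proof.
move=> Rfun PQR.
have yB j := sum_bound xA Adisj (R^~ j).
have Bdisj j j' : j != j' -> \big[setU/set0]_(i | R i j) A i
    `&` \big[setU/set0]_(i | R i j') A i = set0.
  move=> jj'; apply: bigU_disj => // i Rij; apply: contra jj' => Rij'.
  by apply/eqP; apply: Rfun Rij Rij'.
have yE j : tr (yB j) = \big[@tr_add _ _ M/tr_zero M]_(i | R i j) tr (xA i).
  by rewrite (tr_sum xA Adisj (R^~ j)); apply: tr_eq.
have := tr_sum yB Bdisj Q; rewrite (eq_bigr _ (fun j _ => yE j)).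
rewrite (exchange_big_dep P) /=; last by move=> j i Qj Rij; apply/PQR; exists j.
under eq_bigr => i Pi.
  have [j Qj Rij] := (PQR i).1 Pi.
  rewrite (big_pred1 j); last first.
    move=> j' /=; apply/andP/eqP => [[_ Rij']|->]; last by [].
    exact: Rfun Rij' Rij.
  over.
by rewrite (tr_sum xA Adisj P) => -[].
Qed.

Lemma sum_ind3 (K1 K2 K3 X1 X2 X3 : Type)
    (M1 : pcm K1 X1) (M2 : pcm K2 X2) (M3 : pcm K3 X3)
    (Z : X1 -> X2 -> X3 -> Prop) (I : finType)
    (x1 : I -> X1) (A1 : I -> set K1) (x2 : I -> X2) (A2 : I -> set K2)
    (x3 : I -> X3) (A3 : I -> set K3) (P : pred I) :
  (forall i, pcm_bound M1 (x1 i) (A1 i)) ->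
  (forall i j, i != j -> A1 i `&` A1 j = set0) ->
  (forall i, pcm_bound M2 (x2 i) (A2 i)) ->
  (forall i j, i != j -> A2 i `&` A2 j = set0) ->
  (forall i, pcm_bound M3 (x3 i) (A3 i)) ->
  (forall i j, i != j -> A3 i `&` A3 j = set0) ->
  Z (pcm_zero M1) (pcm_zero M2) (pcm_zero M3) ->
  (forall i, Z (x1 i) (x2 i) (x3 i)) ->
  (forall a1 b1 B1 D1 a2 b2 B2 D2 a3 b3 B3 D3,
     pcm_bound M1 a1 B1 -> pcm_bound M1 b1 D1 -> B1 `&` D1 = set0 ->
     pcm_bound M2 a2 B2 -> pcm_bound M2 b2 D2 -> B2 `&` D2 = set0 ->
     pcm_bound M3 a3 B3 -> pcm_bound M3 b3 D3 -> B3 `&` D3 = set0 ->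
     Z a1 a2 a3 -> Z b1 b2 b3 ->
     Z (pcm_add M1 a1 b1) (pcm_add M2 a2 b2) (pcm_add M3 a3 b3)) ->
  Z (\big[pcm_add M1/pcm_zero M1]_(i | P i) x1 i)
    (\big[pcm_add M2/pcm_zero M2]_(i | P i) x2 i)
    (\big[pcm_add M3/pcm_zero M3]_(i | P i) x3 i).
Proof.
move=> b1 d1 b2 d2 b3 d3 Z0 Zx ZD.
elim: (index_enum I) (index_enum_uniq I) => [|i r IH] /=; first by rewrite !big_nil.
move=> /andP[ir ur]; rewrite !big_cons; case: (P i); last exact: IH.
have [s1 _] := sum_boundP b1 d1 P ur.
have [s2 _] := sum_boundP b2 d2 P ur.
have [s3 _] := sum_boundP b3 d3 P ur.
apply: ZD (b1 i) s1 _ (b2 i) s2 _ (b3 i) s3 _ (Zx i) (IH ur); exact: disj_notin.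
Qed.

Section ParsummableSums.
Variable C : parsummable.
Implicit Types (x y z : ob C) (f g k : mor C).

Definition obound (x : ob C) (A : set nat) := finite_set A /\ supported x A.

Definition mbound (f : mor C) (A : set (bool * nat)) :=
  obound (cdom f) [set n | A (true, n)] /\ obound (ccod f) [set n | A (false, n)].

Lemma obound_disj x y A B : obound x A -> obound y B -> A `&` B = set0 ->
  disjointly_supported x y.
Proof. by move=> [fA sA] [fB sB] AB; exists A, B; split. Qed.

Lemma mbound_disj f g A B : mbound f A -> mbound g B -> A `&` B = set0 ->
  disjointly_supported (cdom f) (cdom g) /\ disjointly_supported (ccod f) (ccod g).
Proof.
move=> [fA fA'] [gB gB'] AB; split.
  apply: obound_disj fA gB _; rewrite -subset0 => n [/= An Bn].
  by suff : set0 (true, n) by []; rewrite -AB; split.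
apply: obound_disj fA' gB' _; rewrite -subset0 => n [/= An Bn].
by suff : set0 (false, n) by []; rewrite -AB; split.
Qed.

Lemma tadd_obE x y (h : disjointly_supported x y) :
  tadd_ob x y = fob (padd C) (box_ob h).
Proof.
by rewrite /tadd_ob; case: pselect => // h'; congr fob; apply: sig_eq.
Qed.

Lemma tadd_morE f g h h' : tadd_mor f g = fmor (padd C) (@box_mor C C f g h h').
Proof.
rewrite /tadd_mor; case: pselect => // k; case: pselect => // k'.
by congr fmor; apply: sig_eq.
Qed.

Lemma tadd_ob_act u x y : disjointly_supported x y ->
  aob u (tadd_ob x y) = tadd_ob (aob u x) (aob u y).
Proof.
move=> h; rewrite (tadd_obE h) (tadd_obE (disjointly_supported_act u h)).
by rewrite -mfun_ob; congr fob; apply: sig_eq.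
Qed.

Lemma cdom_tadd f g : disjointly_supported (cdom f) (cdom g) ->
  disjointly_supported (ccod f) (ccod g) ->
  cdom (tadd_mor f g) = tadd_ob (cdom f) (cdom g).
Proof.
move=> h h'; rewrite (tadd_morE h h') (tadd_obE h) fdom.
by congr fob; apply: sig_eq.
Qed.

Lemma ccod_tadd f g : disjointly_supported (cdom f) (cdom g) ->
  disjointly_supported (ccod f) (ccod g) ->
  ccod (tadd_mor f g) = tadd_ob (ccod f) (ccod g).
Proof.
move=> h h'; rewrite (tadd_morE h h') (tadd_obE h') fcod.
by congr fob; apply: sig_eq.
Qed.

Lemma tadd_id x y : disjointly_supported x y ->
  tadd_mor (idm x) (idm y) = idm (tadd_ob x y).
Proof.
move=> h.
have h1 : disjointly_supported (cdom (idm x)) (cdom (idm y)) by rewrite !cdom_id.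
have h2 : disjointly_supported (ccod (idm x)) (ccod (idm y)) by rewrite !ccod_id.
rewrite (tadd_morE h1 h2) (tadd_obE h) -fid.
by congr fmor; apply: sig_eq.
Qed.

Lemma tadd_comp g f (g' f' : mor C) h h' h'' :
  disjointly_supported (cdom g) (cdom g') -> disjointly_supported (ccod g) (ccod g') ->
  disjointly_supported (cdom f) (cdom f') -> disjointly_supported (ccod f) (ccod f') ->
  tadd_mor (ccomp g f h) (ccomp g' f' h')
  = ccomp (tadd_mor g g') (tadd_mor f f') h''.
Proof.
move=> d1 d2 d3 d4.
have k1 : disjointly_supported (cdom (ccomp g f h)) (cdom (ccomp g' f' h')).
  by rewrite !cdom_comp.
have k2 : disjointly_supported (ccod (ccomp g f h)) (ccod (ccomp g' f' h')).
  by rewrite !ccod_comp.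
rewrite (tadd_morE k1 k2).
have e : cdom (box_mor d1 d2) = ccod (box_mor d3 d4).
  by apply: sig_eq; rewrite /= h h'.
have e' : cdom (fmor (padd C) (box_mor d1 d2)) = ccod (fmor (padd C) (box_mor d3 d4)).
  by rewrite fdom fcod e.
transitivity (fmor (padd C) (ccomp (box_mor d1 d2) (box_mor d3 d4) e)).
  by congr fmor; apply: sig_eq => /=; congr pair; apply: ccomp_eq.
rewrite (fcomp _ e'); apply: ccomp_eq; by rewrite -tadd_morE.
Qed.

Lemma tadd_mor_act u v f g : disjointly_supported (cdom f) (cdom g) ->
  disjointly_supported (ccod f) (ccod g) ->
  amor u v (tadd_mor f g) = tadd_mor (amor u v f) (amor u v g).
Proof.
move=> h h'; rewrite (tadd_morE h h').
have k : disjointly_supported (cdom (amor u v f)) (cdom (amor u v g)).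
  by rewrite !cdom_amor; apply: disjointly_supported_act.
have k' : disjointly_supported (ccod (amor u v f)) (ccod (amor u v g)).
  by rewrite !ccod_amor; apply: disjointly_supported_act.
by rewrite (tadd_morE k k') -mfun_mor; congr fmor; apply: sig_eq.
Qed.

Lemma obound0 : obound (pzero C) set0.
Proof. by split; [exact: finite_set0|move=> u _; apply: pzero_fixed]. Qed.

Lemma oboundD x y A B : obound x A -> obound y B -> A `&` B = set0 ->
  obound (tadd_ob x y) (A `|` B).
Proof.
move=> hx hy AB; have h := obound_disj hx hy AB.
case: hx hy => [fA sA] [fB sB]; split; first by rewrite finite_setU.
move=> u hu; rewrite tadd_ob_act // sA ?sB // => n Xn; apply: hu; by [left|right].
Qed.

Lemma mbound0 : mbound (idm (pzero C)) set0.
Proof. by split; rewrite ?cdom_id ?ccod_id; apply: obound0. Qed.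

Lemma preim_disj (b : bool) (A B : set (bool * nat)) : A `&` B = set0 ->
  [set n | A (b, n)] `&` [set n | B (b, n)] = set0.
Proof.
move=> AB; rewrite -subset0 => n [/= An Bn].
by suff : set0 (b, n) by []; rewrite -AB; split.
Qed.

Lemma mboundD f g A B : mbound f A -> mbound g B -> A `&` B = set0 ->
  mbound (tadd_mor f g) (A `|` B).
Proof.
move=> hf hg AB; have [h h'] := mbound_disj hf hg AB.
case: hf hg => [f1 f2] [g1 g2]; split.
  by rewrite cdom_tadd //; apply: oboundD f1 g1 _; apply: preim_disj.
by rewrite ccod_tadd //; apply: oboundD f2 g2 _; apply: preim_disj.
Qed.

Lemma disjointly_supportedC x y : disjointly_supported x y ->
  @disjointly_supported C C y x.
Proof. by move=> [A [B [? ? ? ? ?]]]; exists B, A; split; rewrite // setIC. Qed.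

Program Definition pcm_ob : pcm nat (ob C) :=
  @Pcm nat (ob C) obound (@tadd_ob C) (pzero C) obound0 oboundD _ _ _.
Next Obligation.
move=> x A hx; have h := obound_disj hx obound0 (setI0 _).
by rewrite (tadd_obE h) paddx0_ob.
Qed.
Next Obligation.
move=> x y A B hx hy AB; have h := obound_disj hx hy AB.
by rewrite (tadd_obE h) (tadd_obE (disjointly_supportedC h)); apply: paddC_ob.
Qed.
Next Obligation.
move=> x y z A B D hx hy hz AB AD BD.
have hxy := obound_disj hx hy AB; have hyz := obound_disj hy hz BD.
have hxz := obound_disj hx hz AD.
have h1 : disjointly_supported (tadd_ob x y) z.
  by apply: obound_disj (oboundD hx hy AB) hz _; rewrite setIUl AD BD setU0.
have h2 : disjointly_supported x (tadd_ob y z).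
  by apply: obound_disj hx (oboundD hy hz BD) _; rewrite setIUr AB AD setU0.
rewrite (tadd_obE h1) (tadd_obE h2).
move: h1 h2; rewrite (tadd_obE hxy) (tadd_obE hyz) => h1 h2.
by apply/esym; apply: paddA_ob.
Qed.

Program Definition pcm_mor : pcm (bool * nat) (mor C) :=
  @Pcm (bool * nat) (mor C) mbound (@tadd_mor C) (idm (pzero C)) mbound0 mboundD _ _ _.
Next Obligation.
move=> f A hf; have [h h'] := mbound_disj hf mbound0 (setI0 _).
by rewrite (tadd_morE h h') paddx0_mor.
Qed.
Next Obligation.
move=> f g A B hf hg AB; have [h h'] := mbound_disj hf hg AB.
rewrite (tadd_morE h h') (tadd_morE (disjointly_supportedC h) (disjointly_supportedC h')).
exact: paddC_mor.
Qed.
Next Obligation.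
move=> f g k A B D hf hg hk AB AD BD.
have [hfg hfg'] := mbound_disj hf hg AB; have [hgk hgk'] := mbound_disj hg hk BD.
have [hfk hfk'] := mbound_disj hf hk AD.
have [h1 h1'] : disjointly_supported (cdom (tadd_mor f g)) (cdom k) /\
    disjointly_supported (ccod (tadd_mor f g)) (ccod k).
  by apply: mbound_disj (mboundD hf hg AB) hk _; rewrite setIUl AD BD setU0.
have [h2 h2'] : disjointly_supported (cdom f) (cdom (tadd_mor g k)) /\
    disjointly_supported (ccod f) (ccod (tadd_mor g k)).
  by apply: mbound_disj hf (mboundD hg hk BD) _; rewrite setIUr AB AD setU0.
rewrite (tadd_morE h1 h1') (tadd_morE h2 h2').
move: h1 h1' h2 h2'; rewrite (tadd_morE hfg hfg') (tadd_morE hgk hgk') => h1 h1' h2 h2'.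
by apply/esym; apply: paddA_mor.
Qed.

(* By functoriality and unitality the endomorphism [(u, v)] of [0] is an
   idempotent isomorphism. *)
Lemma amor_zero u v : amor u v (idm (pzero C)) = idm (pzero C).
Proof.
set z := idm (pzero C); set e := amor u v z.
have e1 : cdom e = pzero C by rewrite cdom_amor cdom_id pzero_fixed.
have e2 : ccod e = pzero C by rewrite ccod_amor ccod_id pzero_fixed.
have zz : disjointly_supported (pzero C) (pzero C).
  exact: obound_disj obound0 obound0 (setI0 _).
have z1 : cdom z = pzero C by rewrite cdom_id.
have z2 : ccod z = pzero C by rewrite ccod_id.
have bz : mbound z set0 := mbound0.
have be : mbound e set0 by split; rewrite ?e1 ?e2; apply: obound0.
have ze : tadd_mor z e = e.
  have := pcm_addC (p := pcm_mor) bz be (setI0 _); rewrite /= => ->.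
  exact: (pcm_addx0 (p := pcm_mor) be).
have ez : tadd_mor e z = e by exact: (pcm_addx0 (p := pcm_mor) be).
have ee : tadd_mor e e = e.
  rewrite /e -tadd_mor_act; try by rewrite ?z1 ?z2.
  by congr amor; exact: (pcm_addx0 (p := pcm_mor) bz).
have c1 : cdom e = ccod z by rewrite e1 z2.
have c2 : cdom z = ccod e by rewrite e2 z1.
have c3 : cdom e = ccod e by rewrite e1 e2.
have eez : e = ccomp e e c3.
  have c4 : cdom (tadd_mor e z) = ccod (tadd_mor z e) by rewrite ez ze.
  rewrite -[LHS]ee.
  have E1 : e = ccomp e z c1 by rewrite ccomp_idr.
  have E2 : e = ccomp z e c2 by rewrite ccomp_idl.
  rewrite {1}E1 {2}E2 (tadd_comp _ _ c4); try by rewrite ?e1 ?e2 ?z1 ?z2.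
  exact: ccomp_eq.
pose i := amor v u z.
have i1 : cdom i = pzero C by rewrite cdom_amor cdom_id pzero_fixed.
have ie : cdom i = ccod e by rewrite i1 e2.
have zid : z = ccomp z z (etrans z1 (esym z2)).
  by rewrite ccomp_idr.
have iez : ccomp i e ie = z.
  have -> : z = amor u u z by rewrite amor_id pzero_fixed.
  rewrite [in RHS]zid (amor_comp (v := v) _ ie); exact: ccomp_eq.
rewrite -iez.
have k2 : cdom i = ccod (ccomp e e c3) by rewrite ccod_comp.
have k3 : cdom (ccomp i e ie) = ccod e by rewrite cdom_comp.
have : ccomp i e ie = ccomp (ccomp i e ie) e k3.
  by rewrite -(@ccompA C i e e ie c3 k2 k3); apply: ccomp_eq.
by move=> ->; move: k3; rewrite iez => k3; rewrite ccomp_idl.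
Qed.

Lemma obound_supp (x : ob C) : obound x (supp x).
Proof. exact: supp_min (ptame x). Qed.

Definition msupp (f : mor C) : set (bool * nat) :=
  [set p | if p.1 then supp (cdom f) p.2 else supp (ccod f) p.2].

Lemma mbound_supp (f : mor C) : mbound f (msupp f).
Proof. by split; apply: obound_supp. Qed.

Lemma supp_act u (x : ob C) : supp (aob u x) `<=` u @` supp x.
Proof.
have [f s] := obound_supp x; apply: supp_sub; first exact: finite_image.
exact: supported_aob.
Qed.

Lemma supp_act_disj u (x y : ob C) : supp x `&` supp y = set0 ->
  supp (aob u x) `&` supp (aob u y) = set0.
Proof.
move=> /(image_disj u) h; rewrite -subset0 -h.
by apply: setISS; apply: supp_act.
Qed.

End ParsummableSums.

(* Based maps [m_+ -> n_+], where [n_+] is ['I_n.+1] with base point [ord0];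
   the element [lift ord0 i] of [n_+] corresponds to [i : 'I_n]. *)
Record bmap (m n : nat) := BMap {
  bfun :> 'I_m.+1 -> 'I_n.+1;
  bfun0 : bfun ord0 = ord0
}.

Definition bmap_id n : bmap n n := @BMap n n id erefl.
Definition bmap_comp k m n (f : bmap m n) (g : bmap k m) : bmap k n :=
  @BMap k n (fun i => f (g i)) (etrans (congr1 f (bfun0 g)) (bfun0 f)).

Lemma bmap_eq m n (f g : bmap m n) : f =1 g -> f = g.
Proof.
case: f g => [f hf] [g hg] /= /funext e; subst.
by congr BMap; exact: Prop_irrelevance.
Qed.

Record GammaM := GammaMcat {
  gm : nat -> Mcat;
  gm_map : forall m n, bmap m n -> Mfunctor (gm m) (gm n);
  gm_id_ob : forall n (x : ob (gm n)), fob (gm_map (bmap_id n)) x = x;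
  gm_id_mor : forall n (f : mor (gm n)), fmor (gm_map (bmap_id n)) f = f;
  gm_comp_ob : forall k m n (a : bmap m n) (b : bmap k m) (x : ob (gm k)),
    fob (gm_map (bmap_comp a b)) x = fob (gm_map a) (fob (gm_map b) x);
  gm_comp_mor : forall k m n (a : bmap m n) (b : bmap k m) (f : mor (gm k)),
    fmor (gm_map (bmap_comp a b)) f = fmor (gm_map a) (fmor (gm_map b) f);
  gm_terminal : is_terminal_category (gm 0)
}.

Section GammaC.
Variable C : parsummable.

Definition pairwise_disjoint n (x : 'I_n -> ob C) :=
  forall i j, i != j -> supp (x i) `&` supp (x j) = set0.

(* The [n]-fold box power of [C]. *)
Program Definition boxpow n : Mcat :=
  @fullsubM (powM 'I_n C) (@pairwise_disjoint n) _.
Next Obligation. by move=> n u x h i j /h; apply: supp_act_disj. Qed.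

Variables (m n : nat) (a : bmap m n).

Definition fiber (j : 'I_n) (i : 'I_m) : bool := a (lift ord0 i) == lift ord0 j.

Definition push_ob (x : 'I_m -> ob C) (j : 'I_n) : ob C :=
  \big[@tadd_ob C/pzero C]_(i < m | a (lift ord0 i) == lift ord0 j) x i.

Definition push_mor (f : 'I_m -> mor C) (j : 'I_n) : mor C :=
  \big[@tadd_mor C/idm (pzero C)]_(i < m | a (lift ord0 i) == lift ord0 j) f i.

Lemma push_ob_disj x : pairwise_disjoint x -> pairwise_disjoint (push_ob x).
Proof.
move=> hx j j' jj'.
have b k := @sum_bound _ _ (pcm_ob C) _ _ _ (fun i => obound_supp (x i)) hx (fiber k).
have [f1 s1] := b j; have [f2 s2] := b j'.
rewrite -subset0 -(@bigU_disj _ _ _ hx (fiber j) (fiber j')).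
  by apply: setISS; apply: supp_sub.
move=> i /eqP e; rewrite /fiber e; apply: contra jj' => /eqP/lift_inj ->.
by [].
Qed.

Lemma msupp_disj (f : 'I_m -> mor C) : pairwise_disjoint (fun i => cdom (f i)) ->
  pairwise_disjoint (fun i => ccod (f i)) ->
  forall i j, i != j -> msupp (f i) `&` msupp (f j) = set0.
Proof.
move=> h h' i j ij; rewrite -subset0 => -[[] k] [/= p q].
  by have := h _ _ ij; rewrite -subset0 => /(_ k); apply.
by have := h' _ _ ij; rewrite -subset0 => /(_ k); apply.
Qed.

Lemma push_ind (Z : mor C -> ob C -> Prop) (f : 'I_m -> mor C) (x : 'I_m -> ob C) j :
  pairwise_disjoint (fun i => cdom (f i)) -> pairwise_disjoint (fun i => ccod (f i)) ->
  pairwise_disjoint x ->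
  Z (idm (pzero C)) (pzero C) -> (forall i, Z (f i) (x i)) ->
  (forall f g x y,
     disjointly_supported (cdom f) (cdom g) -> disjointly_supported (ccod f) (ccod g) ->
     disjointly_supported x y -> Z f x -> Z g y -> Z (tadd_mor f g) (tadd_ob x y)) ->
  Z (push_mor f j) (push_ob x j).
Proof.
move=> hd hc hx Z0 Zf ZD.
have hf := msupp_disj hd hc.
apply: (@sum_ind3 _ _ _ _ _ _ (pcm_mor C) (pcm_ob C) (pcm_ob C)
  (fun f x _ => Z f x) _ f _ x _ x _ (fiber j)
  (fun i => mbound_supp (f i)) hf (fun i => obound_supp (x i)) hx
  (fun i => obound_supp (x i)) hx) => //.
move=> a1 b1 B1 D1 a2 b2 B2 D2 _ _ _ _ ha hb BD ha' hb' BD' _ _ _ Za Zb.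
have [d1 d2] := mbound_disj ha hb BD.
by apply: ZD => //; apply: obound_disj ha' hb' BD'.
Qed.

Lemma cdom_push f j : pairwise_disjoint (fun i => cdom (f i)) ->
  pairwise_disjoint (fun i => ccod (f i)) ->
  cdom (push_mor f j) = push_ob (fun i => cdom (f i)) j.
Proof.
move=> h h'; apply: (push_ind (Z := fun f x => cdom f = x)) => //.
  by rewrite cdom_id.
by move=> g k x y d1 d2 d3 <- <-; apply: cdom_tadd.
Qed.

Lemma ccod_push f j : pairwise_disjoint (fun i => cdom (f i)) ->
  pairwise_disjoint (fun i => ccod (f i)) ->
  ccod (push_mor f j) = push_ob (fun i => ccod (f i)) j.
Proof.
move=> h h'; apply: (push_ind (Z := fun f x => ccod f = x)) => //.
  by rewrite ccod_id.
by move=> g k x y d1 d2 d3 <- <-; apply: ccod_tadd.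
Qed.

Lemma push_id x j : pairwise_disjoint x ->
  push_mor (fun i => idm (x i)) j = idm (push_ob x j).
Proof.
move=> h; apply: (push_ind (Z := fun f x => f = idm x)) => //.
- by move=> i i' /h; rewrite !cdom_id.
- by move=> i i' /h; rewrite !ccod_id.
by move=> g k y z d1 d2 d3 -> ->; apply: tadd_id.
Qed.

Lemma push_ob_act u x j : pairwise_disjoint x ->
  push_ob (fun i => aob u (x i)) j = aob u (push_ob x j).
Proof.
move=> h.
have h' : pairwise_disjoint (fun i => aob u (x i)).
  by move=> i i' /h; apply: supp_act_disj.
apply: (@sum_ind3 _ _ _ _ _ _ (pcm_ob C) (pcm_ob C) (pcm_ob C)
  (fun x y _ => x = aob u y) _ (fun i => aob u (x i)) _ x _ x _ (fiber j)
  (fun i => obound_supp _) h' (fun i => obound_supp (x i)) h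
  (fun i => obound_supp (x i)) h) => //=.
  by rewrite pzero_fixed.
move=> a1 b1 B1 D1 a2 b2 B2 D2 _ _ _ _ ha hb BD ha' hb' BD' _ _ _ -> ->.
by rewrite tadd_ob_act //; apply: obound_disj ha' hb' BD'.
Qed.

Lemma push_mor_act u v f j : pairwise_disjoint (fun i => cdom (f i)) ->
  pairwise_disjoint (fun i => ccod (f i)) ->
  push_mor (fun i => amor u v (f i)) j = amor u v (push_mor f j).
Proof.
move=> h h'; have hf := msupp_disj h h'.
have hf' : forall i i', i != i' ->
    msupp (amor u v (f i)) `&` msupp (amor u v (f i')) = set0.
  apply: msupp_disj => i i' ii'; rewrite ?cdom_amor ?ccod_amor;
    apply: supp_act_disj; [exact: h|exact: h'].
apply: (@sum_ind3 _ _ _ _ _ _ (pcm_mor C) (pcm_mor C) (pcm_mor C)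
  (fun x y _ => x = amor u v y) _ (fun i => amor u v (f i)) _ f _ f _ (fiber j)
  (fun i => mbound_supp _) hf' (fun i => mbound_supp (f i)) hf
  (fun i => mbound_supp (f i)) hf) => //=.
  by rewrite amor_zero.
move=> a1 b1 B1 D1 a2 b2 B2 D2 _ _ _ _ ha hb BD ha' hb' BD' _ _ _ -> ->.
by have [d1 d2] := mbound_disj ha' hb' BD'; rewrite tadd_mor_act.
Qed.

Lemma push_comp g f j (h : forall i, cdom (g i) = ccod (f i)) h' :
  pairwise_disjoint (fun i => cdom (f i)) ->
  pairwise_disjoint (fun i => ccod (f i)) ->
  pairwise_disjoint (fun i => ccod (g i)) ->
  push_mor (fun i => ccomp (g i) (f i) (h i)) j
  = ccomp (push_mor g j) (push_mor f j) h'.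
Proof.
move=> h1 h2 h3.
have h4 : pairwise_disjoint (fun i => cdom (g i)) by move=> i i' /h2; rewrite !h.
have hf := msupp_disj h1 h2; have hg := msupp_disj h4 h3.
have hk : forall i i', i != i' ->
    msupp (ccomp (g i) (f i) (h i)) `&` msupp (ccomp (g i') (f i') (h i')) = set0.
  apply: msupp_disj => i i' ii'; rewrite ?cdom_comp ?ccod_comp; [exact: h1|exact: h3].
suff [e ->] : exists e, push_mor (fun i => ccomp (g i) (f i) (h i)) j
    = ccomp (push_mor g j) (push_mor f j) e by exact: ccomp_eq.
apply: (@sum_ind3 _ _ _ _ _ _ (pcm_mor C) (pcm_mor C) (pcm_mor C)
  (fun z x y => exists e, z = ccomp x y e) _ _ _ g _ f _ (fiber j)
  (fun i => mbound_supp _) hk (fun i => mbound_supp (g i)) hg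
  (fun i => mbound_supp (f i)) hf) => /=.
- have e : cdom (idm (pzero C)) = ccod (idm (pzero C)) by rewrite cdom_id ccod_id.
  by exists e; rewrite ccomp_idr.
- by move=> i; exists (h i).
move=> a1 b1 B1 D1 a2 b2 B2 D2 a3 b3 B3 D3 ha hb BD ha' hb' BD' ha'' hb'' BD''.
move=> [e1 ->] [e2 ->].
have [d1 d2] := mbound_disj ha' hb' BD'; have [d3 d4] := mbound_disj ha'' hb'' BD''.
have e : cdom (tadd_mor a2 b2) = ccod (tadd_mor a3 b3).
  by rewrite cdom_tadd // ccod_tadd // e1 e2.
by exists e; apply: tadd_comp.
Qed.

Program Definition gamma_map : Mfunctor (boxpow m) (boxpow n) :=
  @MFunctor (boxpow m) (boxpow n)
    (@Functor (boxpow m) (boxpow n)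
      (fun x => exist _ (push_ob (proj1_sig x)) (push_ob_disj (proj2_sig x)))
      (fun f => exist _ (push_mor (proj1_sig f)) _) _ _ _ _)
    _ _.
Next Obligation.
move=> [f [/= h h']]; split=> /= i j ij; rewrite ?cdom_push ?ccod_push //;
  exact: push_ob_disj.
Qed.
Next Obligation.
by move=> [f [h h']]; apply: sig_eq; apply: funext => j /=; rewrite cdom_push.
Qed.
Next Obligation.
by move=> [f [h h']]; apply: sig_eq; apply: funext => j /=; rewrite ccod_push.
Qed.
Next Obligation.
by move=> [x h]; apply: sig_eq; apply: funext => j /=; rewrite push_id.
Qed.
Next Obligation.
move=> [g [g1 g2]] [f [f1 f2]] h h'; apply: sig_eq; apply: funext => j /=.
exact: push_comp.
Qed.
Next Obligation.
by move=> u [x h]; apply: sig_eq; apply: funext => j /=; rewrite push_ob_act.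
Qed.
Next Obligation.
by move=> u v [f [h h']]; apply: sig_eq; apply: funext => j /=; rewrite push_mor_act.
Qed.

End GammaC.

Lemma fiber_comp k m n (a : bmap m n) (b : bmap k m) (j : 'I_n) (i : 'I_k) :
  fiber (bmap_comp a b) j i <-> exists2 l, fiber a j l & fiber b l i.
Proof.
rewrite /fiber /=; split; last by move=> [l /eqP al /eqP ->]; rewrite al.
case: (unliftP ord0 (b (lift ord0 i))) => [l ->|->]; first by exists l.
by rewrite bfun0.
Qed.

Program Definition gamma (C : parsummable) : GammaM :=
  @GammaMcat (boxpow C) (@gamma_map C) _ _ _ _ _.
Next Obligation.
move=> C n [x h]; apply: sig_eq; apply: funext => j /=.
rewrite /push_ob /= (eq_bigl (fun i => i == j)); last first.
  by move=> i; rewrite (inj_eq lift_inj).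
exact: (@sum_pred1 _ _ (pcm_ob C) _ _ _ (fun i => obound_supp (x i)) h).
Qed.
Next Obligation.
move=> C n [f [h h']]; apply: sig_eq; apply: funext => j /=.
rewrite /push_mor /= (eq_bigl (fun i => i == j)); last first.
  by move=> i; rewrite (inj_eq lift_inj).
apply: (@sum_pred1 _ _ (pcm_mor C) _ _ _ (fun i => mbound_supp (f i))).
exact: msupp_disj.
Qed.
Next Obligation.
move=> C k m n a b [x h]; apply: sig_eq; apply: funext => j /=.
apply/esym; apply: (@sum_sum _ _ (pcm_ob C) _ _ _ _ (fun i => obound_supp (x i)) h
  (fun i l => fiber b l i) (fiber a j) (fiber (bmap_comp a b) j)).
  by move=> i l l' /eqP e /eqP; rewrite e => /lift_inj.
by move=> i; apply: fiber_comp.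
Qed.
Next Obligation.
move=> C k m n a b [f [h h']]; apply: sig_eq; apply: funext => j /=.
apply/esym; apply: (@sum_sum _ _ (pcm_mor C) _ _ _ _ (fun i => mbound_supp (f i)) _
  (fun i l => fiber b l i) (fiber a j) (fiber (bmap_comp a b) j)).
- exact: msupp_disj.
- by move=> i l l' /eqP e /eqP; rewrite e => /lift_inj.
by move=> i; apply: fiber_comp.
Qed.
Next Obligation.
move=> C.
have h : pairwise_disjoint (fun _ : 'I_0 => pzero C) by case.
exists (exist _ _ h); split => [[x hx]|[f hf]];
  by apply: sig_eq; apply: funext => -[].
Qed.

Record Gcat (gT : finGroupType) := GCat {
  gcat :> category;
  gact : gT -> functor gcat gcat;
  gact1_ob : forall x, fob (gact 1%g) x = x;
  gact1_mor : forall f, fmor (gact 1%g) f = f;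
  gactM_ob : forall g h x, fob (gact (g * h)%g) x = fob (gact g) (fob (gact h) x);
  gactM_mor : forall g h f, fmor (gact (g * h)%g) f = fmor (gact g) (fmor (gact h) f)
}.

Record Gfunctor (gT : finGroupType) (C D : Gcat gT) := GFunctor {
  gfun :> functor C D;
  gfun_ob : forall g x, fob gfun (fob (gact C g) x) = fob (gact D g) (fob gfun x);
  gfun_mor : forall g f, fmor gfun (fmor (gact C g) f) = fmor (gact D g) (fmor gfun f)
}.

Record GammaG (gT : finGroupType) := GammaGcat {
  gg : nat -> Gcat gT;
  gg_map : forall m n, bmap m n -> Gfunctor (gg m) (gg n);
  gg_id_ob : forall n (x : ob (gg n)), fob (gg_map (bmap_id n)) x = x;
  gg_id_mor : forall n (f : mor (gg n)), fmor (gg_map (bmap_id n)) f = f;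
  gg_comp_ob : forall k m n (a : bmap m n) (b : bmap k m) (x : ob (gg k)),
    fob (gg_map (bmap_comp a b)) x = fob (gg_map a) (fob (gg_map b) x);
  gg_comp_mor : forall k m n (a : bmap m n) (b : bmap k m) (f : mor (gg k)),
    fmor (gg_map (bmap_comp a b)) f = fmor (gg_map a) (fmor (gg_map b) f);
  gg_terminal : is_terminal_category (gg 0)
}.

(* The left action underlying one of the library's right actions. *)
Definition lact (gT : finGroupType) (D : {set gT}) (T : Type)
    (to : action D T) (g : gT) (x : T) : T := to x g^-1%g.

Lemma lact1 (gT : finGroupType) (H : {group gT}) (T : Type) (to : action H T) x :
  lact to 1%g x = x.
Proof.
rewrite /lact invg1; case: to => to [inj_to actM] /=.
by apply: (inj_to 1%g); rewrite -actM ?group1 // mulg1.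
Qed.

Lemma lactM (gT : finGroupType) (H : {group gT}) (T : Type) (to : action H T) g h x :
  g \in H -> h \in H -> lact to (g * h)%g x = lact to g (lact to h x).
Proof.
rewrite /lact invMg; case: to => to [inj_to actM] /= gH hH.
by rewrite actM ?groupV.
Qed.

Lemma lactK (gT : finGroupType) (H : {group gT}) (T : Type) (to : action H T) g x :
  g \in H -> lact to g^-1%g (lact to g x) = x.
Proof. by move=> gH; rewrite -lactM ?groupV // mulVg lact1. Qed.

Lemma lactKV (gT : finGroupType) (H : {group gT}) (T : Type) (to : action H T) g x :
  g \in H -> lact to g (lact to g^-1%g x) = x.
Proof. by move=> gH; rewrite -lactM ?groupV // mulgV lact1. Qed.

Record enumeration := Enumeration {
  kap : forall U : Type, ([set: U] #= [set: nat])%card -> nat -> U;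
  kapV : forall U : Type, ([set: U] #= [set: nat])%card -> U -> nat;
  kapK : forall U h, cancel (@kap U h) (@kapV U h);
  kapVK : forall U h, cancel (@kapV U h) (@kap U h);
  kap_nat : forall h n, @kap nat h n = n
}.

Lemma enumeration_exists : inhabited enumeration.
Proof.
have key (U : Type) (h : ([set: U] #= [set: nat])%card) :
    {p : (nat -> U) * (U -> nat) | [/\ cancel p.1 p.2, cancel p.2 p.1 &
       forall e : (nat : Type) = U :> Type,
         p.1 = eq_rect (nat : Type) (fun T : Type => nat -> T) id U e]}.
  apply: cid; have [e|ne] := pselect ((nat : Type) = U :> Type).
    by subst; exists (id, id); split=> // e; rewrite (Prop_irrelevance e erefl).
  have /pcard_eqP/unsquash f := h.
  have [g fK gK] := bijTT (f := f).
  by exists (g, f : U -> nat); split=> // e; case: (ne e).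
apply: inhabits; pose k U h := proj1_sig (key U h).
apply: (@Enumeration (fun U h => (k U h).1) (fun U h => (k U h).2)).
- by move=> U h; rewrite /k; case: (key U h) => p [].
- by move=> U h; rewrite /k; case: (key U h) => p [].
by move=> h n; rewrite /k; case: (key nat h) => p [_ _ /(_ erefl) /= ->].
Qed.

Lemma transport_inj (kappa : enumeration) (U V : Type)
    (hU : ([set: U] #= [set: nat])%card) (hV : ([set: V] #= [set: nat])%card)
    (j : U -> V) :
  injective j -> injective (fun n => kapV kappa hV (j (kap kappa hU n))).
Proof.
move=> hj; apply: inj_comp; last exact: inj_comp hj (can_inj (@kapK _ _ _)).
exact: can_inj (@kapVK _ _ _).
Qed.

Definition transport (kappa : enumeration) (U V : Type) hU hV (j : U -> V)
    (hj : injective j) : inj := Inj (@transport_inj kappa U V hU hV j hj).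

Section Evaluation.
Variables (kappa : enumeration) (gT : finGroupType) (U : Type).
Variables (hU : ([set: U] #= [set: nat])%card) (to : {action gT &-> U}).

Lemma lact_inj g : injective (lact to g).
Proof. by move=> x y; rewrite /lact; case: (to) => f [f_inj _] /f_inj. Qed.

Definition transport_act (g : gT) : inj := transport kappa hU hU (lact_inj (g := g)).

Lemma transport_act1 : transport_act 1%g = inj_one.
Proof. by apply: inj_eq_ext => n /=; rewrite lact1 kapK. Qed.

Lemma transport_actM g h :
  transport_act (g * h)%g = inj_mul (transport_act g) (transport_act h).
Proof. by apply: inj_eq_ext => n /=; rewrite lactM ?inE // kapVK. Qed.

(* [D[U]] *)
Program Definition eval_cat (D : Mcat) : Gcat gT :=
  @GCat gT D (fun g => astar D (transport_act g)) _ _ _ _.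
Next Obligation. by move=> D x /=; rewrite transport_act1 aob1. Qed.
Next Obligation. by move=> D f /=; rewrite transport_act1 amor1. Qed.
Next Obligation. by move=> D g h x /=; rewrite transport_actM aobM. Qed.
Next Obligation. by move=> D g h f /=; rewrite transport_actM amorM. Qed.

Program Definition eval_functor (C D : Mcat) (F : Mfunctor C D) :
    Gfunctor (eval_cat C) (eval_cat D) := @GFunctor gT _ _ F _ _.
Next Obligation. by move=> C D F g x /=; rewrite mfun_ob. Qed.
Next Obligation. by move=> C D F g f /=; rewrite mfun_mor. Qed.

(* [Y[U]] *)
Definition eval (Y : GammaM) : GammaG gT :=
  @GammaGcat gT (fun n => eval_cat (gm Y n))
    (fun m n a => eval_functor (gm_map Y a))
    (@gm_id_ob Y) (@gm_id_mor Y) (@gm_comp_ob Y) (@gm_comp_mor Y) (@gm_terminal Y).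

End Evaluation.

(* A Gamma-object [Y] is extended to finite based sets [S_+ = option S] by
   [Y(S_+) = Y(n_+)] for [n = #|S|], along the bijection [S_+ -> n_+] provided
   by the enumeration of [S]. *)
Definition plus_rank (S : finType) (x : option S) : 'I_#|S|.+1 :=
  if x is Some s then lift ord0 (enum_rank s) else ord0.

Definition plus_val (S : finType) (i : 'I_#|S|.+1) : option S :=
  omap enum_val (unlift ord0 i).

Lemma plus_rankK (S : finType) : cancel (@plus_rank S) (@plus_val S).
Proof. by case=> [s|]; rewrite /plus_val /= ?liftK ?unlift_none //= enum_rankK. Qed.

Lemma plus_valK (S : finType) : cancel (@plus_val S) (@plus_rank S).
Proof.
move=> i; rewrite /plus_val; case: (unliftP ord0 i) => [j ->|->] //=.
by rewrite enum_valK.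
Qed.

Lemma plus_val0 (S : finType) : @plus_val S ord0 = None.
Proof. by rewrite /plus_val unlift_none. Qed.

Program Definition plus_map (S T : finType) (s : S -> T) : bmap #|S| #|T| :=
  @BMap #|S| #|T| (fun i => plus_rank (omap s (plus_val i))) _.
Next Obligation. by move=> S T s /=; rewrite plus_val0. Qed.

(* [p_s : S_+ -> 1_+] *)
Program Definition pmap (S : finType) (s : S) : bmap #|S| 1 :=
  @BMap #|S| 1 (fun i => if plus_val i == Some s then ord_max else ord0) _.
Next Obligation. by move=> S s /=; rewrite plus_val0. Qed.

Section Special.
Variables (gT : finGroupType) (Y : GammaG gT) (H : {group gT}).
Variables (S : finType) (to : action H S).

Definition diag_act (h : gT) : functor (gg Y #|S|) (gg Y #|S|) :=
  functor_comp (gact (gg Y #|S|) h) (gg_map Y (plus_map (lact to h))).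

Program Definition conj_act (h : gT) :
    functor (powcat S (gg Y 1)) (powcat S (gg Y 1)) :=
  @Functor (powcat S (gg Y 1)) (powcat S (gg Y 1))
    (fun x s => fob (gact (gg Y 1) h) (x (lact to h^-1%g s)))
    (fun f s => fmor (gact (gg Y 1) h) (f (lact to h^-1%g s))) _ _ _ _.
Next Obligation. by move=> h f; apply: funext => s /=; rewrite fdom. Qed.
Next Obligation. by move=> h f; apply: funext => s /=; rewrite fcod. Qed.
Next Obligation. by move=> h x; apply: funext => s /=; rewrite fid. Qed.
Next Obligation. by move=> h g f e e'; apply: funext => s; apply: fcomp. Qed.

(* [P_S : Y(S_+) -> map(S, Y(1_+))] *)
Program Definition segal_map : functor (gg Y #|S|) (powcat S (gg Y 1)) :=
  @Functor (gg Y #|S|) (powcat S (gg Y 1))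
    (fun x s => fob (gg_map Y (pmap s)) x)
    (fun f s => fmor (gg_map Y (pmap s)) f) _ _ _ _.
Next Obligation. by move=> f; apply: funext => s /=; rewrite fdom. Qed.
Next Obligation. by move=> f; apply: funext => s /=; rewrite fcod. Qed.
Next Obligation. by move=> x; apply: funext => s /=; rewrite fid. Qed.
Next Obligation. by move=> g f e e'; apply: funext => s; apply: fcomp. Qed.

Lemma pmap_act h s : h \in H ->
  bmap_comp (pmap s) (plus_map (lact to h)) = pmap (lact to h^-1%g s).
Proof.
move=> hH; apply: bmap_eq => i /=; rewrite plus_rankK.
case: (plus_val i) => //= t; congr (if _ then _ else _).
apply/eqP/eqP => -[] => [<-|->]; first by rewrite lactK.
by rewrite lactKV.
Qed.

Lemma segal_ob h : h \in H -> forall x,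
  fob segal_map (fob (diag_act h) x) = fob (conj_act h) (fob segal_map x).
Proof.
move=> hH x; apply: funext => s /=.
by rewrite gfun_ob -gg_comp_ob pmap_act.
Qed.

Lemma segal_mor h : h \in H -> forall f,
  fmor segal_map (fmor (diag_act h) f) = fmor (conj_act h) (fmor segal_map f).
Proof.
move=> hH x; apply: funext => s /=.
by rewrite gfun_mor -gg_comp_mor pmap_act.
Qed.

(* [(P_S)^H : Y(S_+)^H -> map^H(S, Y(1_+))] *)
Definition segal_fixed :
    functor (fixcat (fun h => h \in H) diag_act) (fixcat (fun h => h \in H) conj_act) :=
  fix_functor segal_ob segal_mor.

End Special.

Definition special (gT : finGroupType) (Y : GammaG gT) :=
  forall (H : {group gT}) (S : finType) (to : action H S),
    is_weak_equivalence_cat (segal_fixed Y to).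

Definition is_stabilizer (gT : finGroupType) (U : Type) (to : {action gT &-> U})
    (x : U) (H : {set gT}) := forall g, (g \in H) <-> lact to g x = x.

Definition universal_Gset (gT : finGroupType) (U : Type) (to : {action gT &-> U}) :=
  countable [set: U] /\
  forall H : {group gT}, infinite_set [set x | is_stabilizer to x H].

Lemma universal_card (gT : finGroupType) (U : Type) (to : {action gT &-> U}) :
  universal_Gset to -> ([set: U] #= [set: nat])%card.
Proof.
move=> [cU iU]; apply: eq_card_nat => // fU; apply: (iU 1%G).
exact: sub_finite_set fU.
Qed.

Lemma universal_Gset_exists (gT : finGroupType) :
  exists (U : Type) (to : {action gT &-> U}), universal_Gset to.
Proof.
pose act (x : nat * {set gT}) (g : gT) := (x.1, (x.2 :* g)%g).
have a1 : act^~ 1%g =1 id by case=> n A; rewrite /act /= mulg1.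
have aM : forall x, act_morph act x by move=> [n A] g h; rewrite /act /= rcosetM.
exists (nat * {set gT})%type, (TotalAction a1 aM); split; first exact: countableP.
move=> H /(finite_image fst) h; apply: infinite_nat.
apply: sub_finite_set h => n _; exists (n, H : {set gT}) => //= g.
rewrite /lact /= /act /=; split=> [gH|[e]].
  by rewrite rcoset_id ?groupV.
  have : (g^-1 \in H :* g^-1)%g by rewrite mem_rcoset mulgV group1.
  by rewrite e groupV.
Qed.

(* The condition is imposed for all universal [G]-sets; there is one by
   [universal_Gset_exists]. *)
Definition globally_special (kappa : enumeration) (Y : GammaM) :=
  forall (gT : finGroupType) (U : Type) (to : {action gT &-> U})
    (hU : universal_Gset to),
  special (eval kappa (universal_card hU) to Y).

(* Main.v *)
(* The functor [(P_S)^H] is injective on objects and morphisms and full, since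
   disjointness of supports is a condition on objects only.  As the [H]-set
   [S * U] is countable and [U] is universal, there is an injective [H]-map
   [phi : S * U -> U].  For an [H]-fixed tuple [y] the tuple of the
   [phi(s, -)_* y_s] is [H]-fixed with disjoint supports, and the morphisms
   [y_s -> phi(s, -)_* y_s] given by the contractibility of [EM] are natural and
   [H]-fixed; so the target deforms into the image of [(P_S)^H]. *)

From mathcomp Require Import all_boot all_fingroup.
From mathcomp Require Import boolp classical_sets functions cardinality.
From Stdlib Require Import Relation_Operators.
Require Import Defs.

Set Implicit Arguments.
Unset Strict Implicit.
Unset Printing Implicit Defensive.

Local Open Scope classical_set_scope.
#[local] Obligation Tactic := idtac.

(** * Homotopies between nerves *)

Lemma smap_eq (X Y : sset) (f g : smap X Y) :
  (forall n (x : simp X n), f n x = g n x) -> f = g.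
Proof.
case: f g => [f hf] [g hg] /= e.
have {}e : f = g by apply: functional_extensionality_dep => n; apply: funext.
by subst; congr SMap; exact: Prop_irrelevance.
Qed.

Lemma homotopic_precomp (W X Z : sset) (w : smap W X) (f g : smap X Z) :
  homotopic f g -> homotopic (smap_comp f w) (smap_comp g w).
Proof.
elim=> {f g} [f g [h [h0 h1]]|f|f g _ IH|f g k _ IH _ IH'].
- apply: rst_step.
  have hP m n (a : mono m n) (x : simp (sprod W (simplex 1)) n) :
      h m (w m (sact a x).1, (sact a x).2) = sact a (h n (w n x.1, x.2)).
    by rewrite -sfunP /= sfunP.
  by exists (SMap hP); split=> k x /=; [apply: h0|apply: h1].
- exact: rst_refl.
- exact: rst_sym.
- exact: rst_trans IH IH'.
Qed.

Lemma elementary_homotopy_postcomp (X Y Z : sset) (w : smap Y Z) (f g : smap X Y) :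
  elementary_homotopy f g -> elementary_homotopy (smap_comp w f) (smap_comp w g).
Proof.
move=> [h [h0 h1]]; exists (smap_comp w h); split=> k x /=; by rewrite ?h0 ?h1.
Qed.

Program Definition pairing (n : nat) (C : category) (A : Type)
    (x : functor (ordcat n) C) (a : 'I_n.+1 -> A) :
    functor (ordcat n) (prodcat C (indiscrete A)) :=
  @Functor (ordcat n) (prodcat C (indiscrete A)) (fun i => (fob x i, a i))
    (fun p => (fmor x p, (a (proj1_sig p).1, a (proj1_sig p).2))) _ _ _ _.
Next Obligation. by move=> n C A x a p /=; rewrite fdom. Qed.
Next Obligation. by move=> n C A x a p /=; rewrite fcod. Qed.
Next Obligation. by move=> n C A x a i; congr pair; apply: fid. Qed.
Next Obligation. by move=> n C A x a g f h h'; congr pair; apply: fcomp. Qed.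

(** The functor [K] amounts to a natural isomorphism. A simplex of the interval is a monotone map,
    and its underlying function gives a functor to the indiscrete category; so [pairing] followed by
    [K] is the homotopy. *)
Lemma nerve_elementary_homotopy (C D : category) (F G : functor C D)
    (K : functor (prodcat C (indiscrete 'I_2)) D) :
  (forall x, fob K (x, ord0) = fob F x) ->
  (forall f, fmor K (f, (ord0, ord0)) = fmor F f) ->
  (forall x, fob K (x, ord_max) = fob G x) ->
  (forall f, fmor K (f, (ord_max, ord_max)) = fmor G f) ->
  elementary_homotopy (nerve_map F) (nerve_map G).
Proof.
move=> Fob Fmor Gob Gmor.
pose h n (x : simp (sprod (nerve C) (simplex 1)) n) : simp (nerve D) n :=
  functor_comp K (pairing x.1 (x.2 : mono n 1)).
have hP m n (a : mono m n) x : h m (sact a x) = sact a (h n x).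
  by apply: functor_eq; apply: funext.
exists (@SMap (sprod (nerve C) (simplex 1)) (nerve D) h hP).
by split=> k x; apply: functor_eq; apply: funext => i /=.
Qed.

(** Here [F] is an isomorphism onto a full subcategory containing the image of [L]. Chosen preimages
    form a functor because the required identities hold after applying [F], which is injective. *)
Lemma functor_lift (B C D : category) (F : functor C D) (L : functor B D) :
  injective (fob F) -> injective (fmor F) ->
  (forall f x y, cdom f = fob F x -> ccod f = fob F y -> exists g, fmor F g = f) ->
  (forall b, exists x, fob F x = fob L b) ->
  exists L' : functor B C, (forall b, fob F (fob L' b) = fob L b) /\
    (forall f, fmor F (fmor L' f) = fmor L f).
Proof.
move=> Fob_inj Fmor_inj Ffull Lob.
have Lmor f : exists g, fmor F g = fmor L f.
  have [x xE] := Lob (cdom f); have [y yE] := Lob (ccod f).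
  by apply: (Ffull _ x y); rewrite ?fdom ?fcod.
have [o oE] := choice Lob; have [m mE] := choice Lmor.
have mdom f : cdom (m f) = o (cdom f) by apply: Fob_inj; rewrite -fdom mE oE fdom.
have mcod f : ccod (m f) = o (ccod f) by apply: Fob_inj; rewrite -fcod mE oE fcod.
have mid x : m (idm x) = idm (o x) by apply: Fmor_inj; rewrite mE !fid oE.
have mcomp g f h h' : m (ccomp g f h) = ccomp (m g) (m f) h'.
  have e : cdom (fmor L g) = ccod (fmor L f) by rewrite fdom fcod h.
  have e' : cdom (fmor F (m g)) = ccod (fmor F (m f)) by rewrite !mE.
  by apply: Fmor_inj; rewrite mE (fcomp _ e) (fcomp _ e'); apply: ccomp_eq.
by exists (Functor mdom mcod mid mcomp).
Qed.

Program Definition prodcat_mapl (B C D : category) (F : functor C D) :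
    functor (prodcat C B) (prodcat D B) :=
  @Functor (prodcat C B) (prodcat D B) (fun x => (fob F x.1, x.2))
    (fun f => (fmor F f.1, f.2)) _ _ _ _.
Next Obligation. by move=> * /=; rewrite fdom. Qed.
Next Obligation. by move=> * /=; rewrite fcod. Qed.
Next Obligation. by move=> * /=; rewrite fid. Qed.
Next Obligation.
by move=> *; congr pair; [apply: fcomp|apply: ccomp_eq].
Qed.

Program Definition const_pair (C : category) (A : Type) (a : A) :
    functor C (prodcat C (indiscrete A)) :=
  @Functor C (prodcat C (indiscrete A)) (fun x => (x, a)) (fun f => (f, (a, a)))
    _ _ _ _.
Next Obligation. by []. Qed.
Next Obligation. by []. Qed.
Next Obligation. by []. Qed.
Next Obligation. by move=> *; congr pair; apply: ccomp_eq. Qed.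

(** The end of [K] at [ord_max] lifts to [G : D -> C], and the restriction of [K] to [C] lifts to
    [K']. Then [K] and [K'] make both composites of [F] and [G] homotopic to identities. *)
Lemma is_weak_equivalence_cat_deformation (C D : category) (F : functor C D)
    (K : functor (prodcat D (indiscrete 'I_2)) D) :
  injective (fob F) -> injective (fmor F) ->
  (forall f x y, cdom f = fob F x -> ccod f = fob F y -> exists g, fmor F g = f) ->
  (forall y, fob K (y, ord0) = y) ->
  (forall f, fmor K (f, (ord0, ord0)) = f) ->
  (forall y, exists x, fob F x = fob K (y, ord_max)) ->
  is_weak_equivalence_cat F.
Proof.
move=> Fob_inj Fmor_inj Ffull K0ob K0mor K1.
have [G [Gob Gmor]] : exists G : functor D C,
    (forall y, fob F (fob G y) = fob K (y, ord_max)) /\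
    (forall f, fmor F (fmor G f) = fmor K (f, (ord_max, ord_max))).
  exact: (functor_lift (L := functor_comp K (const_pair D ord_max))).
have [K' [K'ob K'mor]] : exists K' : functor (prodcat C (indiscrete 'I_2)) C,
    (forall p, fob F (fob K' p) = fob K (fob F p.1, p.2)) /\
    (forall f, fmor F (fmor K' f) = fmor K (fmor F f.1, f.2)).
  apply: (functor_lift (L := functor_comp K (prodcat_mapl (indiscrete 'I_2) F))) => //.
  (* [K] preserves the image of [F] at both ends: it is the identity at [ord0] and lands in that
     image at [ord_max]. *)
  move=> [x a] /=; have [->|->] : a = ord0 \/ a = ord_max.
  - by case: a => [[|[|//]] ?]; [left|right]; apply: val_inj.
  - by exists x; rewrite K0ob.
  exact: K1.
pose idf E := @Functor E E id id (fun _ => erefl) (fun _ => erefl)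
  (fun _ => erefl) (fun g f h h' => ccomp_eq h h' erefl erefl).
have hD : elementary_homotopy (nerve_map (idf D)) (nerve_map (functor_comp F G)).
  by apply: (@nerve_elementary_homotopy _ _ _ _ K) => ? /=; rewrite ?K0ob ?K0mor ?Gob ?Gmor.
have hC : elementary_homotopy (nerve_map (idf C)) (nerve_map (functor_comp G F)).
  apply: (@nerve_elementary_homotopy _ _ _ _ K') => [x|f|x|f] /=;
    by [apply: Fob_inj; rewrite K'ob ?K0ob ?Gob
       |apply: Fmor_inj; rewrite K'mor ?K0mor ?Gmor].
have idE E (Z : sset) (f : smap (nerve E) Z) : smap_comp f (nerve_map (idf E)) = f.
  by apply: smap_eq => n x /=; congr (f n _); apply: functor_eq.
move=> Z _; split=> [f|g g' gg'].
  exists (smap_comp f (nerve_map G)).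
  apply: rst_sym; apply: rst_step; rewrite -[X in elementary_homotopy X _]idE.
  have -> : smap_comp (smap_comp f (nerve_map G)) (nerve_map F)
      = smap_comp f (nerve_map (functor_comp G F)).
    by apply: smap_eq => n x /=; congr (f n _); apply: functor_eq.
  exact: elementary_homotopy_postcomp.
(* Up to homotopy [k] is recovered from its restriction along [F]; this gives injectivity. *)
have retract (k : smap (nerve D) Z) :
    homotopic k (smap_comp (smap_comp k (nerve_map F)) (nerve_map G)).
  apply: rst_step; rewrite -[X in elementary_homotopy X _]idE.
  have -> : smap_comp (smap_comp k (nerve_map F)) (nerve_map G)
      = smap_comp k (nerve_map (functor_comp F G)).
    by apply: smap_eq => n x /=; congr (k n _); apply: functor_eq.
  exact: elementary_homotopy_postcomp.
apply: rst_trans (retract g) _; apply: rst_trans (rst_sym _ _ _ _ (retract g')).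
exact: homotopic_precomp.
Qed.

(** * Equivariant injections into a universal set *)

(** A representative of each [H]-orbit goes to a number whose stabilizer in the whole group is that
    of the representative in [H], and the map is extended equivariantly. Different orbits use
    numbers from different [b]-orbits. *)
Lemma equivariant_injection (gT : finGroupType) (H : {group gT}) (T : countType)
    (a : gT -> T -> T) (b : gT -> nat -> nat) :
  (forall t, a 1%g t = t) ->
  (forall g h t, g \in H -> h \in H -> a (g * h)%g t = a g (a h t)) ->
  (forall n, b 1%g n = n) -> (forall g h n, b (g * h)%g n = b g (b h n)) ->
  (forall (K : {group gT}) N, exists n, N < n /\ forall g, (g \in K) <-> b g n = n) ->
  exists phi : T -> nat, injective phi /\
    forall h t, h \in H -> phi (a h t) = b h (phi t).
Proof.
move=> a1 aM b1 bM univ.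
have bK g : cancel (b g) (b g^-1%g) by move=> n; rewrite -bM mulVg b1.
have aK g t : g \in H -> a g^-1%g (a g t) = t.
  by move=> gH; rewrite -aM ?groupV // mulVg a1.
pose orb t t' := [exists h, (h \in H) && (a h t == t')].
have orbP t t' : reflect (exists2 h, h \in H & a h t = t') (orb t t').
  apply: (iffP existsP) => [[h /andP[hH /eqP e]]|[h hH e]]; exists h => //.
  by rewrite hH e eqxx.
have orbt t : orb t t by apply/orbP; exists 1%g.
(* [choose] depends only on the extent of its predicate, whence [r t] only on
   the orbit of [t]. *)
pose r t := choose (orb t) t.
have orbr t : orb t (r t) by apply: chooseP.
have ra h t : h \in H -> r (a h t) = r t.
  move=> hH.
  have e : orb (a h t) =1 orb t.
    move=> t'; apply/orbP/orbP => -[k kH <-].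
      by exists (k * h)%g; rewrite ?groupM ?aM.
    by exists (k * h^-1)%g; rewrite ?groupM ?groupV // aM ?groupV // aK.
  rewrite /r (eq_choose e); apply: choose_id => //; apply/orbP; by exists h.
have stab_group t : group_set [set h in H | a h t == t]%SET.
  apply/group_setP; split=> [|g h]; rewrite !inE ?group1 ?a1 ?eqxx //.
  by move=> /andP[gH /eqP ge] /andP[hH /eqP he]; rewrite groupM // aM // he ge eqxx.
have pickP t N : exists n, N < n /\ forall g, (g \in Group (stab_group t)) <-> b g n = n.
  exact: univ.
have [p pP] := choice (fun q : T * nat => pickP q.1 q.2).
(* [v n] exceeds all elements of the [b]-orbit of [v (n - 1)], so that distinct
   values of [v] lie in distinct orbits. *)
pose bound m := \max_(g : gT) b g m.
pose next n N := if unpickle n is Some t then p (t, N) else N.+1.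
pose v := fix v n := if n is m.+1 then next m.+1 (bound (v m)) else next 0 0.
have nextP n N : N < next n N.
  by rewrite /next; case: (unpickle n) => // t; case: (pP (t, N)).
have bound_ge g m : b g m <= bound m by apply: (leq_bigmax g).
have v_lt m n : m < n -> bound (v m) < v n.
  elim: n => // n IH; rewrite ltnS leq_eqVlt => /orP[/eqP->|/IH h]; first exact: nextP.
  apply: leq_ltn_trans (nextP _ _); apply: leq_trans (ltnW h) _.
  by rewrite -{1}(b1 (v n)).
(* The index [pickle t] decodes to [t], so [u t] gets the right stabilizer; at indices that decode
   to nothing [v] only has to grow. *)
pose u (t : T) := v (pickle t).
have uP t g : (g \in H) && (a g t == t) <-> b g (u t) = u t.
  have [N ->] : exists N, u t = p (t, N).
    rewrite /u; case e : (pickle t) => [|n] /=; rewrite /next -e pickleK; by eexists.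
  by have [_ /(_ g)] := pP (t, N); rewrite inE.
(* Two numbers in one [b]-orbit are each at most the [bound] of the other, whereas [v] exceeds the
   [bound] of all its earlier values. *)
have u_orb t t' g : b g (u t) = u t' -> t = t'.
  move=> e; apply: (pcan_inj pickleK); case: (ltngtP (pickle t) (pickle t')) => // /v_lt.
    by rewrite ltnNge -/(u t) -/(u t') -e bound_ge.
  by rewrite ltnNge -/(u t) -/(u t') -(bK g (u t)) e bound_ge.
(* Any [h] carrying [r t] to [t] will do: two choices differ by a stabilizer of [r t], which fixes
   [u (r t)] by [uP]. *)
have phiP t : exists n, exists2 h, h \in H & t = a h (r t) /\ n = b h (u (r t)).
  have /orbP[h hH e] := orbr t; exists (b h^-1%g (u (r t))), h^-1%g; rewrite ?groupV //.
  by rewrite -e aK.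
have [phi phiE] := choice phiP; exists phi; split=> [t t'|k t kH].
  have [h hH [te ->]] := phiE t; have [h' h'H [te' ->]] := phiE t' => e.
  (* Equal values put both representatives in one orbit, and the connecting element fixes [u (r t)],
     hence [r t]. *)
  have e1 : b (h'^-1 * h)%g (u (r t)) = u (r t') by rewrite bM e bK.
  have rr := u_orb _ _ _ e1; move: e1; rewrite -rr => /uP/andP[_ /eqP e2].
  by rewrite te te' -rr -{2}e2 -aM ?groupM ?groupV // mulKVg.
have [h hH [te ->]] := phiE t; have [h' h'H [te' ->]] := phiE (a k t).
move: te'; rewrite ra // => te'.
(* Both [k * h] and [h'] carry [r t] to [a k t], so their quotient stabilizes [r t]. *)
have /andP/uP e : (h'^-1 * (k * h) \in H)%g /\ a (h'^-1 * (k * h))%g (r t) == r t.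
  by rewrite !groupM ?groupV // !aM ?groupM ?groupV // -te te' aK.
by rewrite -[in LHS]e -bM mulKVg bM.
Qed.

(** * Homotopies that pass to fixed points *)

(* On objects [(y, i) |-> (u i s)_* y_s]; the indiscrete category [EM] provides
   the morphisms [(u i s)_* y_s -> (u j s)_* y_s]. *)
Program Definition twist (C : Mcat) (S A : Type) (u : A -> S -> inj) :
    functor (prodcat (powcat S C) (indiscrete A)) (powcat S C) :=
  @Functor (prodcat (powcat S C) (indiscrete A)) (powcat S C)
    (fun p s => aob (u p.2 s) (p.1 s))
    (fun f s => amor (u f.2.1 s) (u f.2.2 s) (f.1 s)) _ _ _ _.
Next Obligation. by move=> C S A u f; apply: funext => s /=; rewrite cdom_amor. Qed.
Next Obligation. by move=> C S A u f; apply: funext => s /=; rewrite ccod_amor. Qed.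
Next Obligation. by move=> C S A u x; apply: funext => s /=; rewrite amor_id. Qed.
Next Obligation.
move=> C S A u [g [c c']] [f [b b']] h h'; apply: funext => s /=.
by case: (h) => /= _ e; subst; apply: amor_comp.
Qed.

(** The action on [B] is trivial: equivariance is asked separately for each object and each morphism
    of [B]. *)
Program Definition fix_functorl (C B : category) (I : Type) (J : I -> Prop)
    (a : I -> functor C C) (K : functor (prodcat C B) C)
    (Kob : forall h, J h -> forall x b, fob K (fob (a h) x, b) = fob (a h) (fob K (x, b)))
    (Kmor : forall h, J h -> forall f b,
       fmor K (fmor (a h) f, b) = fmor (a h) (fmor K (f, b))) :
    functor (prodcat (fixcat J a) B) (fixcat J a) :=
  @Functor (prodcat (fixcat J a) B) (fixcat J a)
    (fun x => exist _ (fob K (proj1_sig x.1, x.2)) _)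
    (fun f => exist _ (fmor K (proj1_sig f.1, f.2)) _) _ _ _ _.
Next Obligation.
by move=> C B I J a K Kob Kmor [[x hx] b] h hJ /=; rewrite -Kob // hx.
Qed.
Next Obligation.
by move=> C B I J a K Kob Kmor [[f hf] b] h hJ /=; rewrite -Kmor // hf.
Qed.
Next Obligation. by move=> *; apply: sig_eq; rewrite /= fdom. Qed.
Next Obligation. by move=> *; apply: sig_eq; rewrite /= fcod. Qed.
Next Obligation. by move=> *; apply: sig_eq; rewrite /= -fid. Qed.
Next Obligation.
move=> C B I J a K Kob Kmor g f h h'; apply: sig_eq => /=.
have e : cdom ((proj1_sig g.1, g.2) : mor (prodcat C B))
    = ccod ((proj1_sig f.1, f.2) : mor (prodcat C B)).
  by case: (h) => /= e1 e2; congr pair.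
have e' : cdom (fmor K (proj1_sig g.1, g.2)) = ccod (fmor K (proj1_sig f.1, f.2)).
  by rewrite fdom fcod e.
transitivity (ccomp _ _ e'); last exact: ccomp_eq.
by rewrite -(fcomp e e'); congr fmor; congr pair; apply: ccomp_eq.
Qed.

(** * The Segal functor on fixed points *)

Section SegalFixed.
Variables (gT : finGroupType) (Y : GammaG gT) (H : {group gT}).
Variables (S : finType) (to : action H S).
Hypothesis ob_inj : injective (fob (segal_map Y S)).
Hypothesis mor_inj : injective (fmor (segal_map Y S)).

Lemma segal_fixed_ob_inj : injective (fob (segal_fixed Y to)).
Proof.
by move=> x y /(congr1 (@proj1_sig _ _)) /ob_inj e; apply: sig_eq.
Qed.

Lemma segal_fixed_mor_inj : injective (fmor (segal_fixed Y to)).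
Proof.
by move=> f g /(congr1 (@proj1_sig _ _)) /mor_inj e; apply: sig_eq.
Qed.

(** An injective equivariant functor reflects fixed objects, since [h] moves a preimage to a
    preimage of the same object. Morphisms are treated alike. *)
Lemma segal_fixed_ob_image y :
  (exists x, fob (segal_map Y S) x = proj1_sig y) ->
  exists x, fob (segal_fixed Y to) x = y.
Proof.
case: y => y hy /= [x e]; subst.
have hx h : h \in H -> fob (diag_act Y to h) x = x.
  by move=> hH; apply: ob_inj; rewrite segal_ob // hy.
by exists (exist _ x hx); apply: sig_eq.
Qed.

Lemma segal_fixed_mor_image f :
  (exists g, fmor (segal_map Y S) g = proj1_sig f) ->
  exists g, fmor (segal_fixed Y to) g = f.
Proof.
case: f => f hf /= [g e]; subst.
have hg h : h \in H -> fmor (diag_act Y to h) g = g.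
  by move=> hH; apply: mor_inj; rewrite segal_mor // hf.
by exists (exist _ g hg); apply: sig_eq.
Qed.

End SegalFixed.

(** * The Segal functor of [gamma C] *)

Section GammaSegal.
Variables (C : parsummable) (S : finType).

(** Pushing forward along [pmap s] is thus a sum with one term, so the Segal functor is, up to
    reindexing, the inclusion of tuples with disjoint supports into all tuples. *)
Lemma fiber_pmap (s : S) (j : 'I_1) (i : 'I_#|S|) :
  fiber (pmap s) j i = (i == enum_rank s).
Proof.
rewrite /fiber /= /plus_val liftK /= (ord1 j) (inj_eq Some_inj).
have -> : lift ord0 (ord0 : 'I_1) = ord_max by apply: val_inj.
by rewrite -[RHS](inj_eq enum_val_inj) enum_rankK; case: (_ == s).
Qed.

Lemma push_ob_pmap (x : 'I_#|S| -> ob C) s j : pairwise_disjoint x ->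
  push_ob (pmap s) x j = x (enum_rank s).
Proof.
move=> h; rewrite /push_ob (eq_bigl (fun i => i == enum_rank s)); last first.
  by move=> i; apply: fiber_pmap.
exact: (@sum_pred1 _ _ (pcm_ob C) _ _ _ (fun i => obound_supp (x i)) h).
Qed.

Lemma push_mor_pmap (f : 'I_#|S| -> mor C) s j :
  pairwise_disjoint (fun i => cdom (f i)) -> pairwise_disjoint (fun i => ccod (f i)) ->
  push_mor (pmap s) f j = f (enum_rank s).
Proof.
move=> h h'; rewrite /push_mor (eq_bigl (fun i => i == enum_rank s)); last first.
  by move=> i; apply: fiber_pmap.
apply: (@sum_pred1 _ _ (pcm_mor C) _ _ _ (fun i => mbound_supp (f i))).
exact: msupp_disj.
Qed.

Variables (kappa : enumeration) (gT : finGroupType) (U : Type).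
Variables (hU : ([set: U] #= [set: nat])%card) (toU : {action gT &-> U}).
Notation Y := (eval kappa hU toU (gamma C)).

Lemma segal_obE (x : ob (gg Y #|S|)) s j :
  proj1_sig (fob (segal_map Y S) x s) j = proj1_sig x (enum_rank s).
Proof. by apply: push_ob_pmap; apply: (proj2_sig x). Qed.

Lemma segal_morE (f : mor (gg Y #|S|)) s j :
  proj1_sig (fmor (segal_map Y S) f s) j = proj1_sig f (enum_rank s).
Proof. by apply: push_mor_pmap; case: (proj2_sig f). Qed.

Lemma segal_ob_inj : injective (fob (segal_map Y S)).
Proof.
move=> x y e; apply: sig_eq; apply: funext => i.
by rewrite -(enum_valK i) -!(segal_obE _ _ ord0) e.
Qed.

Lemma segal_mor_inj : injective (fmor (segal_map Y S)).
Proof.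
move=> f g e; apply: sig_eq; apply: funext => i.
by rewrite -(enum_valK i) -!(segal_morE _ _ ord0) e.
Qed.

Lemma segal_ob_image (y : S -> ob (gg Y 1)) :
  (forall s t, s != t ->
    supp (proj1_sig (y s) ord0) `&` supp (proj1_sig (y t) ord0) = set0) ->
  exists x, fob (segal_map Y S) x = y.
Proof.
move=> h.
have hx : pairwise_disjoint (fun i : 'I_#|S| => proj1_sig (y (enum_val i)) ord0).
  by move=> i j ij; apply: h; rewrite (inj_eq enum_val_inj).
exists (exist _ _ hx); apply: funext => s; apply: sig_eq; apply: funext => j.
by rewrite segal_obE /= enum_rankK (ord1 j).
Qed.

Lemma segal_full (f : S -> mor (gg Y 1)) x y :
  (fun s => cdom (f s)) = fob (segal_map Y S) x ->
  (fun s => ccod (f s)) = fob (segal_map Y S) y ->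
  exists g, fmor (segal_map Y S) g = f.
Proof.
move=> fx fy.
(* The source and target of the tuple inherit disjoint supports from [x] and [y]. *)
have ex (i : 'I_#|S|) : cdom (proj1_sig (f (enum_val i)) ord0) = proj1_sig x i.
  have /(congr1 (fun p => proj1_sig p ord0)) := congr1 (@^~ (enum_val i)) fx.
  by rewrite segal_obE enum_valK.
have ey (i : 'I_#|S|) : ccod (proj1_sig (f (enum_val i)) ord0) = proj1_sig y i.
  have /(congr1 (fun p => proj1_sig p ord0)) := congr1 (@^~ (enum_val i)) fy.
  by rewrite segal_obE enum_valK.
pose g (i : 'I_#|S|) := proj1_sig (f (enum_val i)) ord0.
have hg : pairwise_disjoint (fun i => cdom (g i)) /\
    pairwise_disjoint (fun i => ccod (g i)).
  split=> i j ij; rewrite /g ?ex ?ey; [exact: (proj2_sig x)|exact: (proj2_sig y)].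
exists (exist _ g hg); apply: funext => s; apply: sig_eq; apply: funext => j.
by rewrite segal_morE /= /g enum_rankK (ord1 j).
Qed.

End GammaSegal.

(** * Deformation into tuples with disjoint supports *)

(** These are the slices of an injective [H]-map from [S * nat] to [nat], with [nat] carrying the
    action transported from [U]; the second property is its equivariance. *)
Lemma equivariant_family (kappa : enumeration) (gT : finGroupType) (U : Type)
    (hU : ([set: U] #= [set: nat])%card) (toU : {action gT &-> U})
    (H : {group gT}) (S : finType) (to : action H S) :
  universal_Gset toU ->
  exists phi : S -> inj,
    (forall s t m n, phi s m = phi t n -> s = t) /\
    (forall h s, h \in H -> inj_mul (transport_act kappa hU toU h) (phi s)
       = inj_mul (phi (lact to h s)) (transport_act kappa hU toU h)).
Proof.
move=> [_ univ]; pose b := transport_act kappa hU toU.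
pose a g (p : S * nat) := (lact to g p.1, b g p.2).
have [phi [phi_inj phiE]] : exists phi : S * nat -> nat, injective phi /\
    forall h t, h \in H -> phi (a h t) = b h (phi t).
  apply: (equivariant_injection (T := (S * nat)%type) (a := a)
    (b := fun g => b g : nat -> nat)).
  - by move=> [s n]; rewrite /a /b transport_act1 lact1.
  - by move=> g h [s n] gH hH; rewrite /a /b transport_actM lactM.
  - by move=> n; rewrite /b transport_act1.
  - by move=> g h n; rewrite /b transport_actM.
  (* Infinitely many points have stabilizer [K], but only finitely many are coded by numbers up to
     [N]. *)
  move=> K N; apply: contrapT => /forallNP none; apply: (univ K).
  apply: sub_finite_set (finite_image (kap kappa hU) (finite_II N.+1)) => x stab.
  exists (kapV kappa hU x); last exact: kapVK.
  rewrite /= ltnS leqNgt; apply/negP => lt.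
  apply: (none (kapV kappa hU x)); split=> // g.
  rewrite (stab g) /= kapVK; split=> [->//|]; exact: (can_inj (@kapVK kappa U hU)).
have phis_inj s : injective (fun n => phi (s, n)) by move=> m n /phi_inj[].
exists (fun s => Inj (@phis_inj s)); split=> [s t m n /phi_inj[]//|h s hH].
by apply: inj_eq_ext => n; apply/esym; apply: (phiE h (s, n)).
Qed.

Theorem theorem4p13 (kappa : enumeration) (C : parsummable) :
  globally_special kappa (gamma C).
Proof.
move=> gT U toU univ H S to; set hU := universal_card univ.
have [phi [phi_disj phiE]] := equivariant_family kappa hU to univ.
(* The deformation runs from the identity to the maps that push the components apart. *)
pose u (i : 'I_2) s := if i == ord0 then inj_one else phi s.
have uE i h s : h \in H ->
    inj_mul (transport_act kappa hU toU h) (u i (lact to h^-1%g s))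
    = inj_mul (u i s) (transport_act kappa hU toU h).
  rewrite /u => hH; case: (i == ord0); first exact: inj_eq_ext.
  by rewrite phiE // lactKV.
pose Y := eval kappa hU toU (gamma C).
pose K := @twist (gm (gamma C) 1) S 'I_2 u.
have Kob h : h \in H -> forall x i,
    fob K (fob (conj_act Y to h) x, i) = fob (conj_act Y to h) (fob K (x, i)).
  by move=> hH x i; apply: funext => s; rewrite /= -!aobM uE.
have Kmor h : h \in H -> forall f (ij : 'I_2 * 'I_2),
    fmor K (fmor (conj_act Y to h) f, ij) = fmor (conj_act Y to h) (fmor K (f, ij)).
  by move=> hH f ij; apply: funext => s; rewrite /= -!amorM !uE.
apply: (@is_weak_equivalence_cat_deformation _ _ _ (fix_functorl Kob Kmor)).
- exact/segal_fixed_ob_inj/segal_ob_inj.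
- exact/segal_fixed_mor_inj/segal_mor_inj.
- move=> f x y /(congr1 (@proj1_sig _ _)) fx /(congr1 (@proj1_sig _ _)) fy.
  apply: (segal_fixed_mor_image (@segal_mor_inj _ _ _ _ _ _ _)).
  exact: segal_full fx fy.
- by move=> y; apply: sig_eq; apply: funext => s; apply: aob1.
- by move=> f; apply: sig_eq; apply: funext => s; apply: amor1.
move=> y; apply: (segal_fixed_ob_image (@segal_ob_inj _ _ _ _ _ _ _)).
apply: segal_ob_image => s t st.
(* The supports lie in the images of [phi s] and [phi t], which meet only for [s = t]. *)
rewrite -subset0 => n [/supp_act[m _ <-] /supp_act[m' _ /esym/phi_disj e]].
by rewrite e eqxx in st.
Qed.
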